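(* For integers $e,r\ge1$ put $c=e+r$, and let $T$ be the Greenberg-Hastings cellular automaton with $e$ excited and $r$ refractory states and $Z$ its pulse collision subsystem. Let $\rho_c$ be the positive root of $\lambda^{c+1}-\lambda^{c}-1$. For a time-rescaling $\alpha(c)\in\mathbb N$, the topological entropy satisfies $$h(Z,T^{\alpha(c)})=2\ln\left(\rho_c^{\alpha(c)}\right)\sim 2\alpha(c)\frac{\ln c}{c}\qquad\text{as } c\to\infty.$$ In particular, for $\alpha(c)=c$ the topological entropy asymptotically doubles the topological entropy of the full shift on $c$ symbols, i.e. $h(Z,T^{c})\sim 2\ln c$ as $c\to\infty$.
   Context: Cellular automaton: $\mathcal A=\{0,1,\dots,e+r\}$, $E=\{1,\dots,e\}$. $X=\mathcal A^{\mathbb Z}$ carries the product topology. For $x\in X$, $(Tx)_k=x_k+1$ if $1\le x_k\le e+r-1$; $(Tx)_k=0$ if $x_k=e+r$; if $x_k=0$, then $(Tx)_k=1$ when $x_{k-1}\in E$ or $x_{k+1}\in E$, and $(Tx)_k=0$ otherwise. Write $x_{[i,j]}$ for the restriction of $x$ to coordinates $i,\dots,j$ (with $i=-\infty$ or $j=\infty$ allowed). $h(Z,T^n)$ denotes the topological entropy of $T^n|_Z$. The symbol $\sim$ means that the quotient of both sides tends to $1$. Pulse collision subsystem $Z$ (a closed $T$-invariant subset of $X$): for $i,j\in\mathcal A$ put $a_{i,j}=1$ if $(i,j)=(0,0)$, or $j=i+1$ with $0\le i\le e+r-1$, or $(i,j)=(e+r,0)$; otherwise $a_{i,j}=0$.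 Let $S_R=\{x\in X: a_{x_i,x_{i-1}}=1\ \forall i\in\mathbb Z\}$, $S_L=\{x\in X: a_{x_i,x_{i+1}}=1\ \forall i\in\mathbb Z\}$. For $p\in\mathbb Z$ let $S_{R,p}^-$ be the set of $x\in\mathcal A^{\mathbb Z_{\le p}}$ with $a_{x_i,x_{i-1}}=1$ for all $i\le p$, and $S_{L,p}^+$ the set of $x\in\mathcal A^{\mathbb Z_{\ge p}}$ with $a_{x_i,x_{i+1}}=1$ for all $i\ge p$. Let $S_L^R$ be the set of $x\in X\setminus(S_R\cup S_L)$ for which there is $p\in\mathbb Z$ with $x_{[-\infty,p]}\in S_{R,p}^-$ and $x_{[p+1,\infty]}\in S_{L,p+1}^+$; every such $p$ is called a separating position of $x$, and the set $I_{\mathrm{sp}}(x)$ of them is finite for $x\in S_L^R$. Then $Z$ is the set of $x\in X$ such that either $x\in S_R\cup S_L$, or $x\in S_L^R$ and, with $p=\max I_{\mathrm{sp}}(x)$, we have $x_{p+1}=x_p$ or ($x_{[-\infty,p]}\in S_{R,p}^-$ and $x_{[p,\infty]}\in S_{L,p}^+$). *)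

(* Defs.v *)
From HB Require Import structures.
From mathcomp Require Import all_boot all_order all_algebra.
From mathcomp Require Import all_classical all_reals all_analysis.

Set Implicit Arguments.
Unset Strict Implicit.
Unset Printing Implicit Defensive.
Import Order.TTheory GRing.Theory Num.Theory.
Import numFieldNormedType.Exports.

Local Open Scope classical_set_scope.
Local Open Scope ring_scope.

(* Topological entropy (Adler, Konheim, McAndrew) of the restriction f|_Z of a
   continuous map f : X -> X to a compact f-invariant subset Z of X.  The
   relatively open covers of Z are the traces on Z of families of open subsets
   of X whose union contains Z. *)
Section Entropy.
Variables (R : realType) (X : topologicalType).

Definition covers (I : finType) (J : {set I}) (U : I -> set X) (Z : set X) :=
  forall x, Z x -> exists2 i, i \in J & U i x.

(* The least cardinality of a subcover when U covers Z (then J = setT is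
   admissible, so that the default value #|I| of the minimum is harmless). *)
Definition cover_number (Z : set X) (I : finType) (U : I -> set X) : nat :=
  \big[minn/#|I|]_(J : {set I} | `[< covers J U Z >]) #|J|.

(* The join U \/ f^-1 U \/ ... \/ f^-(n-1) U, indexed by the words of length n
   over the index set of U. *)
Definition cover_join (f : X -> X) (n : nat) (I : finType) (U : I -> set X)
    (s : n.-tuple I) : set X :=
  [set x | forall k : 'I_n, U (tnth s k) (iter k f x)].

(* For a cover U of an invariant set, n |-> ln N(cover_join f n U) is
   subadditive, so that the upper limit is a limit. *)
Definition cover_entropy (Z : set X) (f : X -> X) (I : finType)
    (U : I -> set X) : \bar R :=
  limn_esup (fun n =>
    (ln (cover_number Z (cover_join f (n := n) U))%:R / n%:R)%:E).

Definition entropy (Z : set X) (f : X -> X) : \bar R :=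
  ereal_sup [set h | exists (m : nat) (U : 'I_m -> set X),
    [/\ forall i, open (U i), covers [set: 'I_m] U Z
      & h = cover_entropy Z f U]].

End Entropy.

Definition config (n : nat) : topologicalType :=
  prod_topology (fun _ : int => discrete_topology 'I_n : topologicalType).

Definition shiftZ (n : nat) (x : config n) : config n := fun k => x (k + 1).

Section GreenbergHastings.
Variables e r : nat.

Local Notation state := 'I_(e + r).+1.
Local Notation X := (config (e + r).+1).

Definition excited (a : state) : bool := (1 <= a <= e)%N.

Definition GH (x : X) : X := fun k =>
  if (1 <= (x k : state) <= (e + r).-1)%N then inord (x k : state).+1
  else if (x k : state) == (e + r)%N :> nat then ord0
  else if excited (x (k - 1)) || excited (x (k + 1)) then inord 1
  else ord0.

Definition adm (i j : state) : bool :=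
  [|| (i == 0%N :> nat) && (j == 0%N :> nat),
      (i <= (e + r).-1)%N && (j == i.+1 :> nat)
    | (i == (e + r)%N :> nat) && (j == 0%N :> nat)].

Definition SR : set X := [set x | forall i : int, adm (x i) (x (i - 1))].

Definition SL : set X := [set x | forall i : int, adm (x i) (x (i + 1))].

(* SRminus p x: the restriction of x to ]-oo, p] belongs to S_{R,p}^-. *)
Definition SRminus (p : int) : set X :=
  [set x | forall i : int, i <= p -> adm (x i) (x (i - 1))].

(* SLplus p x: the restriction of x to [p, +oo[ belongs to S_{L,p}^+. *)
Definition SLplus (p : int) : set X :=
  [set x | forall i : int, p <= i -> adm (x i) (x (i + 1))].

Definition Isp (x : X) : set int :=
  [set p | SRminus p x /\ SLplus (p + 1) x].

Definition SLR : set X := [set x | ~ (SR `|` SL) x /\ exists p, Isp x p].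

Definition is_max_Isp (x : X) (p : int) : Prop :=
  Isp x p /\ forall q, Isp x q -> q <= p.

Definition Zpc : set X :=
  [set x | (SR `|` SL) x \/
    (SLR x /\ exists2 p, is_max_Isp x p &
       x (p + 1) = x p \/ (SRminus p x /\ SLplus p x))].

End GreenbergHastings.

Arguments shiftZ n x : clear implicits.
Arguments GH e r x : clear implicits.
Arguments Zpc e r : clear implicits.

(* The positive root of lambda^(c+1) - lambda^c - 1, see rho_spec and
   rho_unique. *)
Definition rho (R : realType) (c : nat) : R :=
  get [set x : R | 0 < x /\ root ('X^(c.+1) - 'X^c - 1) x].

Section RhoTheory.
Variable R : realType.

Let rhoE c (x : R) :
  root ('X^(c.+1) - 'X^c - 1) x = (x ^+ c * (x - 1) == 1).
Proof.
by rewrite /root !hornerE mulrBr mulr1 -exprSr subr_eq0.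
Qed.

Lemma rho_spec c :
  0 < rho R c /\ root ('X^(c.+1) - 'X^c - 1) (rho R c).
Proof.
suff: exists x : R, 0 < x /\ root ('X^(c.+1) - 'X^c - 1) x by move/getPex.
have [||x x12 rx] := @poly_ivt R ('X^(c.+1) - 'X^c - 1) 1 2.
- by rewrite ler1n.
- rewrite !hornerE !expr1n subrr sub0r lerN10 /= exprS.
  by rewrite mulr_natl mulr2n addrK subr_ge0 exprn_ege1 // ler1n.
by exists x; split => //; apply: lt_le_trans (ltr01) _; move: x12 => /andP[].
Qed.

Lemma rho_unique c (x : R) :
  0 < x -> root ('X^(c.+1) - 'X^c - 1) x -> x = rho R c.
Proof.
have gt1 (y : R) : 0 < y -> y ^+ c * (y - 1) = 1 -> 1 < y.
  move=> y0 yE; rewrite -subr_gt0 -(pmulr_rgt0 _ (exprn_gt0 c y0)) yE.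
  exact: ltr01.
have lt (y z : R) : 1 < y -> y < z -> y ^+ c * (y - 1) < z ^+ c * (z - 1).
  move=> y1 yz; have y0 : 0 < y := lt_trans ltr01 y1.
  have z0 : 0 < z := lt_trans y0 yz.
  apply: (@le_lt_trans _ _ (z ^+ c * (y - 1))).
    by rewrite ler_pM2r ?subr_gt0 // lerXn2r ?nnegrE ?ltW.
  by rewrite ltr_pM2l ?exprn_gt0 // ltrD2r.
have [r0] := rho_spec c; rewrite rhoE => /eqP rE x0; rewrite rhoE => /eqP xE.
case: (ltgtP x (rho R c)) => // [/(lt _ _ (gt1 _ x0 xE))|/(lt _ _ (gt1 _ r0 rE))].
  by rewrite xE rE ltxx.
by rewrite xE rE ltxx.
Qed.

End RhoTheory.

(* c = e + r -> oo, where (e, r) ranges over the pairs with e, r >= 1. *)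
Definition params_infty : set_system (nat * nat) :=
  [set A | exists N : nat, forall e r : nat,
     (1 <= e)%N -> (1 <= r)%N -> (N <= e + r)%N -> A (e, r)].

Global Instance params_infty_proper : ProperFilter params_infty.
Proof.
split=> [[N PN]|].
  by have := PN N.+1 1%N isT isT (leqW (leq_addr 1 N)).
split=> [|P Q [M PM] [N QN]|P Q PQ [N PN]].
- by exists 0%N.
- exists (maxn M N) => e r e1 r1; rewrite geq_max => /andP[Mer Ner].
  by split; [exact: PM | exact: QN].
- by exists N => e r e1 r1 Ner; exact/PQ/PN.
Qed.

(* f ~ g along F: the quotient f / g tends to 1. *)
Definition asymp (R : realType) (T : Type) (F : set_system T)
    (f g : T -> \bar R) : Prop :=
  (f x / g x)%E @[x --> F] --> (1%E : \bar R).

(* Main.v *)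
Require Import Defs.
From HB Require Import structures.
From mathcomp Require Import all_boot all_order all_algebra.
From mathcomp Require Import all_classical all_reals all_analysis.
From mathcomp Require Import zify ring lra.

(* Upper bound: Z is compact and invariant, and the n-th iterates near the
   origin are determined by a window of length about 2n, on which a point of Z
   carries a right-moving word followed by a left-moving one.  Words of length
   n of either kind number at most a constant times rho^n, because
   (1, rho^-c, ..., rho^-1) is an eigenvector of their transition matrix.

   Lower bound: concatenate blocks of a fixed length L that all contain the
   same number of pulses (by pigeonhole, about rho^L of them are available) on
   both sides of the origin.  Colliding pulses annihilate in pairs, so the
   numbers of pulses used up on the two sides stay equal; hence the separating
   position stays within L + 1 of the origin, and a finite window observes the
   blocks of both sides independently.

   Asymptotics: s = c ln rho satisfies s e^s <= c <= 2 s e^s for large c,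
   whence s ~ ln c. *)

Set Implicit Arguments.
Unset Strict Implicit.
Unset Printing Implicit Defensive.
Import Order.TTheory GRing.Theory Num.Theory.
Import numFieldNormedType.Exports.

Local Open Scope classical_set_scope.
Local Open Scope ring_scope.

(** * Growth of the root rho as c tends to infinity *)

Section RhoAsymptotics.
Variable R : realType.
Implicit Types (c : nat) (x : R).

Lemma rho_gt0 c : 0 < rho R c.
Proof. by case: (rho_spec R c). Qed.

Lemma rho_eq c : rho R c ^+ c * (rho R c - 1) = 1.
Proof.
have [_] := rho_spec R c; rewrite /root !hornerE subr_eq0 => /eqP h.
by rewrite mulrBr mulr1 -exprSr h.
Qed.

Lemma rho_gt1 c : 1 < rho R c.
Proof.
by rewrite -subr_gt0 -(pmulr_rgt0 _ (exprn_gt0 c (rho_gt0 c))) rho_eq ltr01.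
Qed.

Lemma rho_le2 c : rho R c <= 2.
Proof.
rewrite leNgt; apply/negP => r2.
have : 1 <= rho R c ^+ c by rewrite exprn_ege1 // ltW // rho_gt1.
by have := rho_eq c; nra.
Qed.

Lemma ln_le_subr1 x : 0 < x -> ln x <= x - 1.
Proof. by move=> x0; rewrite -{1}(subrK 1 x) addrC le_ln1Dx // ltrBrDr addNr. Qed.

Lemma subr1V_le_ln x : 0 < x -> 1 - x^-1 <= ln x.
Proof.
move=> x0; have := @ln_le_subr1 x^-1; rewrite lnV ?posrE // invr_gt0.
by move=> /(_ x0); lra.
Qed.

Lemma ln_rho_gt0 c : 0 < ln (rho R c).
Proof. by rewrite ln_gt0 // rho_gt1. Qed.

Lemma expR_ln_rho c : expR (c%:R * ln (rho R c)) = rho R c ^+ c.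
Proof. by rewrite mulrC expRM_natr lnK // posrE rho_gt0. Qed.

(* With s := c ln rho, the equation of rho reads e^s (rho - 1) = 1, so that
   ln rho <= rho - 1 gives s e^s <= c. *)
Lemma ln_rho_upper c : (4 <= c)%N -> c%:R * ln (rho R c) <= ln c%:R.
Proof.
move=> c4; have c0 : 0 < c%:R :> R by rewrite ltr0n; lia.
(* The bound [4 <= c] gives [ln c >= 1], which settles the case [s <= 1] below. *)
have ln4 : 1 <= ln 4 :> R.
  rewrite (_ : 4 = 2 ^+ 2 :> R); last by rewrite expr2; ring.
  rewrite lnXn // mulr2n.
  by have := @subr1V_le_ln 2 ltac:(lra); lra.
have lnc : 1 <= ln c%:R :> R.
  by apply: le_trans ln4 _; rewrite ler_ln ?posrE // ?ler_nat //; lra.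
set s := c%:R * _.
have [s1|s1] := leP s 1; first exact: le_trans s1 lnc.
have es : expR s * s <= c%:R.
  have := rho_eq c; rewrite -expR_ln_rho -/s => h.
  have l := ln_le_subr1 (rho_gt0 c).
  have : expR s * ln (rho R c) <= 1.
    by have := ler_pM2l (expR_gt0 s) (ln (rho R c)) (rho R c - 1); rewrite h l.
  by rewrite -(ler_pM2l c0) mulr1 mulrCA.
rewrite -(expRK s) ler_ln ?posrE ?expR_gt0 //.
apply: le_trans es; rewrite ler_peMr ?expR_ge0 // ltW //.
Qed.

(** Since [rho <= 2], one has [rho - 1 <= rho * ln rho <= 2 * ln rho], hence [c <= 2 * s * expR s]
    with [s = c * ln rho]. After taking logarithms, the error [ln (2 * s)] is bounded by a linear
    function of small slope [x / 2] at the price of the constant [ln (4 / x)]. *)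
Lemma ln_rho_lower c x : (4 <= c)%N -> 0 < x ->
  ln c%:R * (1 - x / 2) <= c%:R * ln (rho R c) + ln (4 / x).
Proof.
move=> c4 x0; have c0 : 0 < c%:R :> R by rewrite ltr0n; lia.
have le_s := ln_rho_upper c4; set s := c%:R * _ in le_s *.
have s0 : 0 < s by rewrite mulr_gt0 ?ln_rho_gt0.
have hl : c%:R <= expR s * (2 * s).
  have := rho_eq c; rewrite -expR_ln_rho -/s => h.
  have r0 := rho_gt0 c; have r2 := rho_le2 c; have l0 := ln_rho_gt0 c.
  have l2 : rho R c - 1 <= 2 * ln (rho R c).
    suff : rho R c - 1 <= rho R c * ln (rho R c) by nra.
    have := subr1V_le_ln r0; rewrite -(ler_pM2l r0) mulrBr divff ?gt_eqF //.
    by rewrite mulr1.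
  have : 1 <= expR s * (2 * ln (rho R c)).
    by rewrite -[leLHS]h ler_pM2l // expR_gt0.
  move=> /(ler_wpM2l (ltW c0)); rewrite mulr1 => /le_trans; apply.
  by rewrite le_eqVlt; apply/orP; left; apply/eqP; rewrite /s; ring.
clearbody s.
have : ln c%:R <= s + ln (2 * s).
  rewrite -[X in X + _](expRK s) -lnM ?posrE ?expR_gt0 ?mulr_gt0 //.
  by rewrite ler_ln ?posrE // mulr_gt0 ?expR_gt0 ?mulr_gt0.
have -> : 2 * s = (s * x / 2) * (4 / x) by field; rewrite gt_eqF.
rewrite lnM ?posrE ?divr_gt0 ?mulr_gt0 //.
have /ltW := @ln_sublinear R (s * x / 2) ltac:(rewrite divr_gt0 ?mulr_gt0 //).
nra.
Qed.

Lemma ln_rho_asymp :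
  (fun c => c%:R * ln (rho R c) / ln c%:R) @ \oo --> (1 : R).
Proof.
apply/cvgrPdist_le => x x0.
near=> c.
have c4 : (4 <= c)%N by near: c; exact: nbhs_infty_ge.
have c0 : 0 < c%:R :> R by rewrite ltr0n; lia.
have lnc0 : 0 < ln c%:R :> R by rewrite ln_gt0 // ltr1n; lia.
(* From this threshold on, [ln (4 / x)] is at most [x / 2 * ln c], so that the two errors add up to
   [x]. *)
have big : 2 * ln (4 / x) / x <= ln c%:R.
  rewrite -(expRK (2 * _ / _)) ler_ln ?posrE ?expR_gt0 //.
  by near: c; exact: nbhs_infty_ger.
have up := ln_rho_upper c4; have lo := ln_rho_lower c4 x0.
have h1 : c%:R * ln (rho R c) / ln c%:R <= 1 by rewrite ler_pdivrMr // mul1r.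
have h2 : 1 - x <= c%:R * ln (rho R c) / ln c%:R.
  rewrite ler_pdivlMr //.
  by move: big; rewrite ler_pdivrMr //; nra.
by rewrite ler_norml; lra.
Unshelve. all: by end_near. Qed.

End RhoAsymptotics.

(** * Cylinders and compactness in the configuration space *)

Section WordTopology.
Variable n : nat.
Implicit Types (x y : config n) (u v : int).

Definition agree u v x y := forall i : int, u <= i <= v -> x i = y i.

Lemma nbhs_coord x (i : int) : nbhs x [set y : config n | x i = y i].
Proof.
have : nbhs (x i) [set z : discrete_topology 'I_n | x i = z] by [].
exact: (@proj_continuous int (fun=> discrete_topology 'I_n) i x).
Qed.

Lemma nbhs_agree u v x : nbhs x (agree u v x).
Proof.
have : nbhs x [set y | forall k : 'I_(`|v - u|).+1, x (u + k%:Z) = y (u + k%:Z)].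
  pose f (k : 'I_(`|v - u|).+1) := [set y : config n | x (u + k%:Z) = y (u + k%:Z)].
  exact: (@filter_forall _ _ f (nbhs x) _ (fun k => nbhs_coord x (u + k%:Z))).
apply: filterS => y xy i uiv.
have iv : (`|i - u| < `|v - u|.+1)%N by lia.
have -> : i = u + (Ordinal iv)%:Z by rewrite /=; lia.
exact: xy.
Qed.

(** The product topology is the supremum of the topologies pulled back along the coordinates, so it
    is enough that the filter of central cylinders converges to [x] in each coordinate. *)
Lemma nbhs_agree_sub x (A : set (config n)) : nbhs x A ->
  exists m : nat, agree (- m%:Z) m x `<=` A.
Proof.
pose F : set_system (config n) :=
  [set B | exists m : nat, agree (- m%:Z) m x `<=` B].
have FF : Filter F.
  split; first by exists 0%N.
  - move=> B C [m mB] [k kC]; exists (maxn m k) => y xy.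
    by split; [apply: mB|apply: kC] => i ik; apply: xy; lia.
  - by move=> B C BC [m mB]; exists m; apply: subset_trans BC.
have : F --> x.
  apply/cvg_sup => i B [_ [[C _ <-] Cx] CB].
  by exists `|i|%N => y xy; apply: CB; rewrite /= -xy //; lia.
exact.
Qed.

Lemma open_agree u v (A : set (config n)) :
  (forall x y, agree u v x y -> A x -> A y) -> open A.
Proof.
move=> AP; rewrite openE => x Ax; apply: filterS (nbhs_agree u v x) => y xy.
exact: AP xy Ax.
Qed.

Lemma closureP (A : set (config n)) x :
  closure A x <-> forall m : nat, exists2 y, A y & agree (- m%:Z) m x y.
Proof.
split=> [Ax m|Ax B /nbhs_agree_sub[m mB]].
  by have [y []] := Ax _ (nbhs_agree (- m%:Z) m x); exists y.
by have [y Ay xy] := Ax m; exists y; split => //; exact: mB.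
Qed.

Lemma config_compact : compact [set: config n].
Proof.
have := @tychonoff int (fun=> discrete_topology 'I_n) (fun=> setT) _.
rewrite (_ : [set f | _] = setT); last by apply/seteqP.
apply => i; exact/finite_compact/finite_finset.
Qed.

(* A Lebesgue number: otherwise the points of Z whose m-cylinder lies in no
   member of the cover would cluster at a point of Z as m grows. *)
Lemma lebesgue_number (Z : set (config n)) (I : Type) (U : I -> set (config n)) :
  compact Z -> (forall i, open (U i)) -> (forall x, Z x -> exists i, U i x) ->
  exists m : nat, forall x, Z x -> exists i, agree (- m%:Z) m x `<=` U i.
Proof.
move=> cZ oU ZU.
pose B m := [set x | Z x /\ ~ exists i, agree (- m%:Z) m x `<=` U i].
have [[m Bm]|nB] := pselect (exists m, B m = set0).
  exists m => x Zx; apply: contrapT => nU.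
  by have : B m x by []; rewrite Bm.
have Bsub m k : (m <= k)%N -> B k `<=` B m.
  move=> mk x [Zx nk]; split => // -[i mi]; apply: nk; exists i => y xy.
  by apply: mi => j jm; apply: xy; lia.
pose F : set_system (config n) := [set C | exists m, B m `<=` C].
have PF : ProperFilter F.
  split=> [[m Bm]|].
    by apply: nB; exists m; apply/seteqP.
  split; first by exists 0%N.
  - move=> C D [m mC] [k kD]; exists (maxn m k) => x Bx; split.
      by apply: mC; apply: Bsub Bx; rewrite leq_maxl.
    by apply: kD; apply: Bsub Bx; rewrite leq_maxr.
  - by move=> C D CD [m mC]; exists m; apply: subset_trans CD.
have [|p [Zp cp]] := cZ F PF; first by exists 0%N => x [].
have [i Ui] := ZU p Zp.
have [m mU] : exists m : nat, agree (- m%:Z) m p `<=` U i.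
  by apply: nbhs_agree_sub; exact: open_nbhs_nbhs.
have [x [[_ nx] px]] := cp (B m) _ (ex_intro _ m (@subset_refl _ _))
  (nbhs_agree (- m%:Z) m p).
case: nx; exists i => y xy; apply: mU => j jm.
by rewrite px // xy.
Qed.

End WordTopology.

(** * Estimates of minimal subcovers *)

Section CoverNumber.
Variables (X : topologicalType) (Z : set X) (I : finType) (V : I -> set X).

Lemma cover_number_le (J : {set I}) : covers J V Z ->
  (cover_number Z V <= #|J|)%N.
Proof.
move=> JZ; rewrite /cover_number.
have : J \in index_enum {set I} by rewrite mem_index_enum.
elim: index_enum => // K r IH; rewrite big_cons inE => /predU1P[<-|/IH {}IH].
  by rewrite (asboolT JZ) geq_minl.
by case: ifP => // _; apply: leq_trans (geq_minr _ _) IH.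
Qed.

Lemma cover_number_ge k : covers [set: I] V Z ->
  (forall J : {set I}, covers J V Z -> (k <= #|J|)%N) ->
  (k <= cover_number Z V)%N.
Proof.
move=> VZ kJ; rewrite /cover_number; elim/big_ind: _ => [|i j ki kj|J /asboolP].
- by rewrite -cardsT kJ.
- by rewrite leq_min ki kj.
- exact: kJ.
Qed.

(** For each code value, pick one member of the cover that contains all points of [Z] with this
    code; the members picked form a subcover. *)
Lemma cover_number_le_code (T : eqType) (code : X -> T) (P : seq T) :
  (forall x, Z x -> code x \in P) ->
  (forall x, Z x -> exists i, forall y, Z y -> code y = code x -> V i y) ->
  (cover_number Z V <= size P)%N.
Proof.
move=> ZP codeV.
pose good t i := `[< forall y, Z y -> code y = t -> V i y >].
pose g t := [pick i | good t i].
have sz : (#|[set i in pmap g P]| <= size P)%N.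
  rewrite cardsE; apply: leq_trans (card_size _) _.
  by rewrite size_pmap count_size.
apply: leq_trans sz; apply: cover_number_le => x Zx.
have [i iP] := codeV _ Zx.
have [j gj] : exists j, g (code x) = Some j.
  rewrite /g; case: pickP => [j _|/(_ i)]; first by exists j.
  by move=> /negbT/negP[]; apply/asboolP.
exists j.
  rewrite inE mem_pmap -gj; apply: map_f; exact: ZP.
move: gj; rewrite /g; case: pickP => // k /asboolP kP [<-].
exact: kP.
Qed.

(** Sending each [t] to a member of the subcover that contains [pt t] is injective, because no
    member contains two of these points. *)
Lemma cover_number_ge_points (T : finType) (pt : T -> X) :
  covers [set: I] V Z -> (forall t, Z (pt t)) ->
  (forall i t t', V i (pt t) -> V i (pt t') -> t = t') ->
  (#|T| <= cover_number Z V)%N.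
Proof.
move=> VZ Zpt inj; apply: cover_number_ge => // J JZ.
have gP t : exists i, (i \in J) && `[< V i (pt t) >].
  by have [i iJ Vi] := JZ _ (Zpt t); exists i; rewrite iJ; apply/asboolP.
pose g t := xchoose (gP t).
have gJ t : g t \in J by have /andP[] := xchooseP (gP t).
have gV t : V (g t) (pt t) by have /andP[_ /asboolP] := xchooseP (gP t).
have g_inj : injective g.
  by move=> t t' tt'; apply: (inj (g t)); [|rewrite tt']; exact: gV.
rewrite -(card_codom g_inj); apply: subset_leq_card.
by apply/fintype.subsetP => _ /codomP[t ->].
Qed.

End CoverNumber.

(** * Bounds on upper limits *)

Section LimnEsup.
Variable R : realType.
Implicit Types (u : nat -> R) (l : R).

Lemma ln_natr_ge0 n : 0 <= ln n%:R :> R.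
Proof. by case: n => [|n]; [rewrite ln0|rewrite ln_ge0 // ler1n]. Qed.

Lemma limn_esup_le_EFin u l :
  (forall eps, 0 < eps -> \forall n \near \oo, u n <= l + eps) ->
  (limn_esup (fun n => (u n)%:E) <= l%:E)%E.
Proof.
move=> ul; apply/lee_addgt0Pr => eps eps0; rewrite -EFinD.
apply: (@le_trans _ _ (ereal_sup ((fun n => (u n)%:E) @` [set n | u n <= l + eps]))).
  by apply: ereal_inf_lbound; exists [set n | u n <= l + eps] => //; exact: ul.
by apply: ge_ereal_sup => _ [n /= un <-]; rewrite lee_fin.
Qed.

Lemma limn_esup_ge_EFin u l :
  (forall eps, 0 < eps -> \forall n \near \oo, l - eps <= u n) ->
  (l%:E <= limn_esup (fun n => (u n)%:E))%E.
Proof.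
move=> ul; apply: le_ereal_inf_tmp => _ [V FV <-].
apply/lee_subgt0Pr => eps eps0; rewrite -EFinB.
have [n [Vn un]] := filter_ex (filterI FV (ul _ eps0)).
by apply: (@le_trans _ _ (u n)%:E); [rewrite lee_fin|apply: ereal_sup_ubound; exists n].
Qed.

Lemma near_le_pdivn (C eps : R) : 0 < eps -> \forall n \near \oo, C / n%:R <= eps.
Proof.
move=> eps0; near=> n.
have n0 : 0 < n%:R :> R by rewrite ltr0n; near: n; exact: nbhs_infty_gt.
rewrite ler_pdivrMr // mulrC -ler_pdivrMr //.
by near: n; exact: nbhs_infty_ger.
Unshelve. all: by end_near. Qed.

End LimnEsup.

(** * Entropy from word counts and from separated points *)

Section ConfigEntropy.
Variables (R : realType) (n : nat) (Z : set (config n)) (f : config n -> config n).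

(* The words that the points of Z carry on the window [u, v] number at most
   N; they are counted through an arbitrary code that determines them. *)
Definition words_bound (u v : int) (N : R) :=
  exists (T : eqType) (code : config n -> T) (P : seq T),
  [/\ forall x, Z x -> code x \in P,
      forall x y, Z x -> Z y -> code x = code y -> agree u v x y
    & (size P)%:R <= N].

Definition local_map (a b : nat) := forall u v x y,
  Z x -> Z y -> agree (u - a%:Z) (v + b%:Z) x y -> agree u v (f x) (f y).

Hypothesis fZ : forall x, Z x -> Z (f x).

Let iterZ k x : Z x -> Z (iter k f x).
Proof. by move=> Zx; elim: k => //= k; exact: fZ. Qed.

Lemma agree_iter a b k u v x y : local_map a b -> Z x -> Z y ->
  agree (u - (a * k)%:Z) (v + (b * k)%:Z) x y ->
  agree u v (iter k f x) (iter k f y).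
Proof.
move=> fab Zx Zy; elim: k u v => [|k IH] u v xy.
  by move=> i uv; apply: xy; lia.
rewrite !iterS; apply: fab; [exact: iterZ|exact: iterZ|apply: IH].
by move=> i uv; apply: xy; lia.
Qed.

(** A Lebesgue number [m] replaces the cover by the cylinders on [[-m, m]]. A word on the window
    enlarged by [a] and [b] per time step then determines a member of the join, and the linear
    factor [k.+1] vanishes in the exponential rate. *)
Lemma entropy_le a b (beta : R) : compact Z -> local_map a b -> 1 <= beta ->
  (forall m : nat, exists2 K : R, 1 <= K & forall k : nat,
     words_bound (- (m + a * k)%:Z) (m + b * k)%:Z
       (K * k.+1%:R * beta ^+ k)) ->
  (entropy R Z f <= (ln beta)%:E)%E.
Proof.
move=> cZ fab b1 wb; apply: ge_ereal_sup => _ [I [U [oU UZ ->]]].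
have b0 : 0 < beta by lra.
have [m mU] : exists m : nat, forall x, Z x ->
    exists i, agree (- m%:Z) m x `<=` U i.
  by apply: lebesgue_number => // x /UZ[i _ Ui]; exists i.
have [K K1 wbK] := wb m; have K0 : 0 < K by lra.
pose N k := cover_number Z (cover_join f (n := k) U).
have Nle k : (N k)%:R <= K * k.+1%:R * beta ^+ k :> R.
  have [T [code [P [ZP codeP szP]]]] := wbK k.
  apply: le_trans szP; rewrite ler_nat.
  apply: (cover_number_le_code (code := code)) => // x Zx.
  have sP (j : 'I_k) : exists i, agree (- m%:Z) m (iter j f x) `<=` U i.
    by apply: mU; exact: iterZ.
  have [s sU] := choice sP.
  exists [tuple s j | j < k] => y Zy yx j.
  rewrite tnth_mktuple; apply: sU.
  apply: (agree_iter fab) => // i uv; symmetry.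
  apply: (codeP y x Zy Zx yx).
  have := leq_mul2l a j k; have := leq_mul2l b j k.
  by have := ltn_ord j; move=> /ltnW ->; rewrite !orbT; lia.
have lnN k : ln (N k)%:R <= ln K + ln k.+1%:R + k%:R * ln beta.
  rewrite mulr_natl -lnXn //.
  rewrite -!lnM ?posrE ?exprn_gt0 ?mulr_gt0 ?ltr0n //.
  have [->|N0] := eqVneq (N k) 0%N.
    rewrite ln0 // ln_ge0 // mulr_ege1 ?exprn_ege1 // mulr_ege1 //.
    by rewrite ler1n.
  rewrite ler_ln ?posrE ?Nle ?ltr0n ?lt0n //.
  by rewrite !mulr_gt0 ?exprn_gt0 ?ltr0n.
apply: limn_esup_le_EFin => eps eps0.
(* Bounding [ln k.+1] by [k.+1 * (eps / 2) - 1 - ln (eps / 2)] leaves exactly this constant besides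
   [k * (ln beta + eps / 2)]. *)
pose C := ln K + eps / 2 - ln (eps / 2) - 1.
have := near_le_pdivn C (divr_gt0 eps0 (ltr0n R 2)).
move=> nearC; near=> k.
have k0 : 0 < k%:R :> R by rewrite ltr0n; near: k; exact: nbhs_infty_gt.
have Ck : C / k%:R <= eps / 2 by near: k.
rewrite ler_pdivrMr //; apply: le_trans (lnN k) _.
move: Ck; rewrite ler_pdivrMr // /C => Ck.
have e20 : 0 < eps / 2 by lra.
have k10 : 0 < k.+1%:R :> R by rewrite ltr0n.
have := ln_le_subr1 (mulr_gt0 k10 e20); rewrite lnM ?posrE //.
rewrite -natr1; nra.
Unshelve. all: by end_near. Qed.

Lemma entropy_ge u v (h C : R) : u <= v ->
  (forall k : nat, exists (T : finType) (pt : T -> config n),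
    [/\ forall t, Z (pt t),
        forall t t', (forall j, (j < k)%N ->
          agree u v (iter j f (pt t)) (iter j f (pt t'))) -> t = t'
      & k%:R * h - C <= ln #|T|%:R]) ->
  (h%:E <= entropy R Z f)%E.
Proof.
move=> uv pts.
pose W := {ffun 'I_(`|v - u|).+1 -> 'I_n}.
pose w (x : config n) : W := [ffun k : 'I_(`|v - u|).+1 => x (u + k%:Z)].
(* The cover is the partition by the words on [[u, v]], so a member of the join fixes the whole
   itinerary seen through this window. *)
pose U (i : 'I_#|W|) := [set x | w x = enum_val i].
have wP x y : w x = w y <-> agree u v x y.
  split=> [/ffunP xy i uiv|xy].
    have iv : (`|i - u| < `|v - u|.+1)%N by lia.
    by have := xy (Ordinal iv); rewrite !ffunE (_ : u + _ = i) //=; lia.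
  apply/ffunP => k; rewrite !ffunE; apply: xy.
  by have := ltn_ord k; lia.
have UT x : U (enum_rank (w x)) x by rewrite /U /= enum_rankK.
apply: (@le_trans _ _ (cover_entropy R Z f U)); last first.
  apply: ereal_sup_ubound; exists #|W|, U; split => //.
    by move=> i; apply: (@open_agree _ u v) => x y /wP xy; rewrite /U /= xy.
  by move=> x _; exists (enum_rank (w x)); rewrite ?inE.
apply: limn_esup_ge_EFin => eps eps0.
have := near_le_pdivn C eps0 => nearC; near=> k.
have k0 : 0 < k%:R :> R by rewrite ltr0n; near: k; exact: nbhs_infty_gt.
have Ck : C / k%:R <= eps by near: k.
have [T [pt [Zpt inj hT]]] := pts k.
have TN : (#|T| <= cover_number Z (cover_join f (n := k) U))%N.
  apply: (cover_number_ge_points (pt := pt)) => //.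
    move=> x _; exists [tuple enum_rank (w (iter j f x)) | j < k] => //.
    by move=> j; rewrite tnth_mktuple; exact: UT.
  move=> s t t' st st'; apply: inj => j jk.
  by apply/wP; have := st (Ordinal jk); have := st' (Ordinal jk); rewrite /U /= => -> ->.
rewrite ler_pdivlMr //.
move: Ck; rewrite ler_pdivrMr // => Ck.
have : ln #|T|%:R <= ln (cover_number Z (cover_join f (n := k) U))%:R :> R.
  have [T0|T0] := posnP #|T|.
    by rewrite T0 ln0 // ln_natr_ge0.
  by rewrite ler_ln ?posrE ?ler_nat ?ltr0n // (leq_trans T0 TN).
nra.
Unshelve. all: by end_near. Qed.

End ConfigEntropy.

(** * Entropy of the full shift *)

Section FullShift.
Variables (R : realType) (n : nat).

Lemma iter_shiftZ j (x : config n) i : iter j (shiftZ n) x i = x (i + j%:Z).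
Proof.
elim: j i => [|j IH] i; first by rewrite addr0.
by rewrite iterS /shiftZ IH; congr (x _); lia.
Qed.

Lemma entropy_shiftZ : (0 < n)%N ->
  entropy R setT (shiftZ n) = (ln n%:R)%:E.
Proof.
move=> n0; have n1 : 1 <= n%:R :> R by rewrite ler1n.
have np : 0 < n%:R :> R by rewrite ltr0n.
apply/eqP; rewrite eq_le; apply/andP; split.
  apply: (@entropy_le R n setT (shiftZ n) _ 0 1) => //.
  - exact: config_compact.
  - by move=> u v x y _ _ xy i uv; rewrite /shiftZ; apply: xy; lia.
  move=> m; exists (n%:R ^+ (2 * m).+1) => [|k]; first exact: exprn_ege1.
  pose T := {ffun 'I_((2 * m).+1 + k) -> 'I_n}.
  pose code (x : config n) : T := [ffun j : 'I__ => x (- m%:Z + j%:Z)].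
  exists T, code, (enum T); split=> [x _|x y _ _ /ffunP xy i uv|].
  - by rewrite mem_enum.
  - have iv : (`|(i + m%:Z)%R| < (2 * m).+1 + k)%N by lia.
    have e : - m%:Z + (Ordinal iv)%:Z = i by rewrite /=; lia.
    by have := xy (Ordinal iv); rewrite !ffunE e.
  - rewrite -cardE card_ffun !card_ord natrX exprD ler_pM2r ?exprn_gt0 //.
    by rewrite ler_peMr ?exprn_ge0 ?ler1n // ltW.
apply: (@entropy_ge R n setT (shiftZ n) 0 0 _ 0) => // k.
pose o := Ordinal n0.
(* The shift brings coordinate [j] to the origin at time [j], so only coordinates 0 to [k - 1] are
   observed; the values elsewhere are arbitrary. *)
exists {ffun 'I_k -> 'I_n}, (fun (t : {ffun 'I_k -> 'I_n}) (i : int) =>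
  if insub `|i|%N is Some j then t j else o).
split=> // [t t' tt'|].
  apply/ffunP => j; have := tt' j (ltn_ord j) 0.
  by rewrite !iter_shiftZ add0r /= valK; apply.
by rewrite card_ffun !card_ord natrX lnXn // subr0 mulr_natl.
Qed.

End FullShift.

(** * One step of the automaton around a collision *)

Definition pulse_step (c : nat) : rel nat := fun i j =>
  [|| (i == 0%N) && (j == 0%N), (i < c)%N && (j == i.+1) | (i == c) && (j == 0%N)].

Section Dynamics.
Variables e r : nat.
Hypotheses (e1 : (1 <= e)%N) (r1 : (1 <= r)%N).
Local Notation state := 'I_(e + r).+1.
Local Notation X := (config (e + r).+1).
Implicit Types (x : X) (z y : nat -> state) (P Q i : int) (a b : nat).

Definition gh_rule (l m q : nat) : nat :=
  if (1 <= m <= (e + r).-1)%N then m.+1 else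
  if m == (e + r)%N then 0%N else ((1 <= l <= e) || (1 <= q <= e))%N.

Lemma admE (i j : state) : adm i j = pulse_step (e + r) i j.
Proof. by rewrite /adm /pulse_step; lia. Qed.

Lemma GH_val x i :
  GH e r x i = gh_rule (x (i - 1) : state) (x i : state) (x (i + 1) : state) :> nat.
Proof.
rewrite /GH /gh_rule /excited.
have := ltn_ord (x i : state); case: ifP => h1 h; first by rewrite inordK //; lia.
case: ifP => //= h2; case: ifP => //= h3; rewrite inordK //; lia.
Qed.

Lemma GH_eq x i (s : state) :
  gh_rule (x (i - 1) : state) (x i : state) (x (i + 1) : state) = s ->
  GH e r x i = s.
Proof. by move=> h; apply: val_inj; rewrite /= -h -GH_val. Qed.

(** The delicate case is [x i = 0]: the right neighbour is then 0 or [e + r], which is not excited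
    as [r >= 1], whereas a left neighbour 1 is excited as [e >= 1]. The cell thus copies its left
    neighbour. *)
Lemma GH_right x i : adm (x i) (x (i - 1)) -> adm (x (i + 1)) (x i) ->
  GH e r x i = x (i - 1).
Proof.
rewrite !admE => h1 h2; apply: GH_eq.
by move: h1 h2; rewrite /gh_rule /pulse_step; do ![case: ifP]; lia.
Qed.

Definition mirror x : X := fun i => x (- i).

Lemma GH_mirror x : GH e r (mirror x) = mirror (GH e r x).
Proof.
apply/funext => i; apply: val_inj; rewrite /mirror.
apply: etrans (GH_val _ _) (etrans _ (esym (GH_val x (- i)))).
rewrite (_ : - (i - 1) = - i + 1); last by lia.
rewrite (_ : - (i + 1) = - i - 1); last by lia.
by rewrite /gh_rule orbC.
Qed.

(** Read outwards from the separating position, the R-type left half and the L-type right half obey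
    this same condition, which makes the two sides interchangeable under [mirror]. *)
Definition chain z := forall k, adm (z k) (z k.+1).

(* x is R-type up to P and L-type from Q on; reading outwards from the
   separating position it shows z from index a on, resp. y from index b on. *)
Definition tracks x z y a b P Q :=
  [/\ Q = P \/ Q = P + 1,
      forall i (k : nat), i <= P -> i + k%:Z = P + a%:Z -> x i = z k,
      forall i (k : nat), Q <= i -> k%:Z - i = b%:Z - Q -> x i = y k
    & z a = y b].

Lemma tracks_mirror x z y a b P Q :
  tracks x z y a b P Q -> tracks (mirror x) y z b a (- Q) (- P).
Proof.
move=> [PQ xz xy zy]; split=> //; first by lia.
  by move=> i k iQ ik; apply: xy; lia.
by move=> i k iQ ik; apply: xz; lia.
Qed.

(** Each pulse is counted by its front, the state 1. *)
Definition pulses z a := count (fun k => z k == 1%N :> nat) (iota 0 a.+1).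

Lemma pulsesS z a : pulses z a.+1 = (pulses z a + (z a.+1 == 1%N :> nat))%N.
Proof. by rewrite /pulses -(addn1 a.+1) iotaD count_cat /= addn0. Qed.

(** Both half-words move one cell towards each other, and the sides use up equally many pulses; the
    balance is written additively to avoid truncated subtraction. *)
Definition next_tracks x z y a b P Q := exists a' b' P' Q',
  [/\ tracks (GH e r x) z y a' b' P' Q', P' + a'%:Z = P + a%:Z + 1,
      b'%:Z - Q' = b%:Z - Q + 1
    & (pulses z a' + pulses y b = pulses z a + pulses y b')%N].

Lemma GH_left_of x z y a b P Q i (k : nat) : chain z ->
  tracks x z y a b P Q -> i < P -> i + k%:Z = P + a%:Z + 1 -> GH e r x i = z k.
Proof.
move=> cz [_ xz _ _] iP; case: k => [|[|k]] ik; [lia|lia|].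
rewrite GH_right.
- by apply: xz; lia.
- rewrite (xz i k.+1) ?(xz (i - 1) k.+2); try lia; exact: cz.
- rewrite (xz i k.+1) ?(xz (i + 1) k); try lia; exact: cz.
Qed.

Lemma GH_right_of x z y a b P Q i (k : nat) : chain y ->
  tracks x z y a b P Q -> Q < i -> k%:Z - i = b%:Z - Q + 1 -> GH e r x i = y k.
Proof.
move=> cy /tracks_mirror tr iQ ik.
have := @GH_left_of _ _ _ _ _ _ _ (- i) k cy tr.
by rewrite GH_mirror /mirror opprK; apply; lia.
Qed.

(** A pulse arrives from the left while the right side is at rest, so the separating position is
    pushed to the right, unless the next letter of [y] is a front that meets the pulse. *)
Lemma tracks_step_right x z y a b P Q : chain z -> chain y ->
  tracks x z y a b P Q -> z a.+1 != y b.+1 -> (z a.+1 == 1%N :> nat) ->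
  next_tracks x z y a b P Q.
Proof.
move=> cz cy tr zy z1; have [PQ xz xy zayb] := tr.
have L i k := @GH_left_of x z y a b P Q i k cz tr.
have Rt i k := @GH_right_of x z y a b P Q i k cy tr.
have := cz a; have := cy b; rewrite -zayb !admE => yb za.
have za0 : z a = 0%N :> nat by move: z1 za; rewrite /pulse_step; lia.
have yb0 : y b = 0%N :> nat by rewrite -zayb.
have yb1 : y b.+1 = 0%N :> nat.
  move: zy yb; rewrite -val_eqE /= (eqP z1) za0 /pulse_step; lia.
have xPz : x P = z a by apply: xz; lia.
have xP1z : x (P - 1) = z a.+1 by apply: xz; lia.
have xQ1y : x (Q + 1) = y b.+1 by apply: xy; lia.
have xQy : x Q = y b by apply: xy; lia.
have GP : GH e r x P = z a.+1.
  apply: GH_eq; rewrite xPz xP1z za0 (eqP z1) /gh_rule /=.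
  by rewrite e1 /=; case: ifP; lia.
have cyb := cy b.+1; rewrite admE yb1 in cyb.
(* Two meeting cells come first: the pulse enters [P], while cell [Q] stays 0 and becomes the single
   meeting cell. *)
case: PQ => QE; last first.
  have xQP : Q - 1 = P by lia.
  exists a, b.+1, Q, Q; split; [split|..]; rewrite ?pulsesS ?yb1 ?addn0 //; try lia.
  - move=> i k iQ ik.
    have [iP|Pi] := ltP i P; first by apply: L; lia.
    have [iQ'|iQ'] := eqVneq i Q; last first.
      have -> : i = P by lia.
      by have -> : k = a.+1 by lia.
    have -> : k = a by lia.
    rewrite iQ'.
    apply: GH_eq; rewrite xQ1y xQP xPz xQy.
    by rewrite yb0 za0 yb1 /gh_rule /=; case: ifP; lia.
  - move=> i k Qi ik.
    have [iQ|iQ] := eqVneq i Q; last by apply: Rt; lia.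
    have -> : k = b.+1 by lia.
    rewrite iQ.
    apply: GH_eq; rewrite xQ1y xQP xPz xQy.
    by rewrite yb0 za0 yb1 /gh_rule /=; case: ifP; lia.
  - by apply: val_inj; rewrite /= za0 yb1.
have xQ2y : x (Q + 2) = y b.+2 by apply: xy; lia.
have GQ1 : GH e r x (Q + 1) = y b.+2.
  apply: GH_eq; rewrite addrK; have -> : Q + 1 + 1 = Q + 2 by lia.
  rewrite xQy xQ1y xQ2y yb0 yb1 /gh_rule /=.
  by move: cyb; rewrite /pulse_step; case: ifP; lia.
(* With a single meeting cell, [P] now carries the pulse front and its right neighbour [y b.+2]. If
   the latter is 0, it is the new meeting cell; if it is 1, two fronts face each other and one pulse
   is counted on each side. *)
have [yb2|yb2] := eqVneq (y b.+2 : nat) 0%N.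
  exists a, b.+2, (P + 1), (P + 1).
  split; [split|..]; rewrite ?pulsesS ?yb1 ?yb2 ?addn0 //; try lia.
  - move=> i k iQ ik.
    have [iP|Pi] := ltP i P; first by apply: L; lia.
    have [iQ'|iQ'] := eqVneq i P.
      by rewrite iQ'; have -> : k = a.+1 by lia.
    have -> : i = Q + 1 by lia.
    have -> : k = a by lia.
    by rewrite GQ1; apply: val_inj; rewrite /= yb2.
  - move=> i k Qi ik.
    have [iQ|iQ] := eqVneq i (Q + 1); last by apply: Rt; lia.
    by rewrite iQ GQ1; have -> : k = b.+2 by lia.
  - by apply: val_inj; rewrite /= za0 yb2.
have yb21 : y b.+2 = 1%N :> nat by move: yb2 cyb; rewrite /pulse_step; lia.
exists a.+1, b.+2, P, (P + 1).
split; [split|..]; rewrite ?pulsesS ?yb1 ?yb21 ?(eqP z1) ?addn0 //; try lia.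
- move=> i k iQ ik.
  have [iP|Pi] := ltP i P; first by apply: L; lia.
  have -> : i = P by lia.
      by have -> : k = a.+1 by lia.
- move=> i k Qi ik.
  have [iQ|iQ] := eqVneq i (Q + 1); last by apply: Rt; lia.
  by rewrite iQ GQ1; have -> : k = b.+2 by lia.
- by apply: val_inj; rewrite /= yb21 (eqP z1).
Qed.

(** If the next letters agree, both sides advance and the site stays. Only state 0 has two
    successors, so letters that differ are 0 and 1, and the side showing 1 pushes the site, up to a
    reflection. *)
Lemma tracks_step x z y a b P Q : chain z -> chain y ->
  tracks x z y a b P Q -> next_tracks x z y a b P Q.
Proof.
move=> cz cy tr; have [PQ xz xy zayb] := tr.
have := cz a; have := cy b; rewrite -zayb !admE => yb za.
have [zy|zy] := eqVneq (z a.+1) (y b.+1).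
  exists a.+1, b.+1, P, Q; split; [split|..] => //; rewrite ?pulsesS ?zy; try lia.
    move=> i k iP ik.
    have [iP'|Pi] := ltP i P.
      by apply: (GH_left_of (i := i) (k := k) cz tr) => //; lia.
    have -> : i = P by lia.
    have -> : k = a.+1 by lia.
    apply: GH_eq.
    rewrite (xz P a) ?(xz (P - 1) a.+1); [|lia..].
    have : x (P + 1) = y b.+1 \/ x (P + 1) = z a.
      case: PQ => QE; [left|right]; first by apply: xy; lia.
      by rewrite zayb; apply: xy; lia.
    case=> ->; rewrite -?zy; move: za; rewrite /gh_rule /pulse_step; do ![case: ifP]; lia.
  move=> i k iP ik.
  have [iP'|Pi] := ltP Q i.
    by apply: (GH_right_of (i := i) (k := k) cy tr) => //; lia.
  have -> : i = Q by lia.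
  have -> : k = b.+1 by lia.
  apply: GH_eq.
  rewrite (xy Q b) ?(xy (Q + 1) b.+1); [|lia..].
  have : x (Q - 1) = z a.+1 \/ x (Q - 1) = y b.
    case: PQ => QE; [left|right]; first by apply: xz; lia.
    by rewrite -zayb; apply: xz; lia.
  case=> ->; rewrite ?zy -?zayb; move: yb; rewrite /gh_rule /pulse_step; do ![case: ifP]; lia.
have [z1|z1] := eqVneq (z a.+1 : nat) 1%N.
  by apply: tracks_step_right => //; rewrite z1.
have y1 : y b.+1 == 1%N :> nat.
  move: zy z1 za yb; rewrite -val_eqE /= /pulse_step; lia.
have yz : y b.+1 != z a.+1 by rewrite eq_sym.
have [b' [a' [Q' [P' [tr' ea eb ep]]]]] :=
  tracks_step_right cy cz (tracks_mirror tr) yz y1.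
exists a', b', (- P'), (- Q'); split; try lia.
have := tracks_mirror tr'; rewrite GH_mirror.
by rewrite (_ : mirror (mirror _) = GH e r x) //; apply/funext => i; rewrite /mirror opprK.
Qed.

End Dynamics.

(** * The pulse collision subsystem is compact and invariant *)

Section PulseCollision.
Variables e r : nat.
Hypotheses (e1 : (1 <= e)%N) (r1 : (1 <= r)%N).
Local Notation state := 'I_(e + r).+1.
Local Notation X := (config (e + r).+1).
Implicit Types (x : X) (z y : nat -> state) (P Q i : int).

(** Both alternatives in the definition of [Zpc] take one form: [Q = P] for halves that overlap in a
    cell, [Q = P + 1] for equal neighbours. *)
Definition glued P Q : set X := [set x |
  [/\ Q = P \/ Q = P + 1, SRminus P x, SLplus Q x & x P = x Q]].

Lemma glued_tracks P Q x : glued P Q x -> exists z y,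
  [/\ chain z, chain y & tracks x z y 0 0 P Q].
Proof.
move=> [PQ xR xL xPQ].
exists (fun k => x (P - k%:Z)), (fun k => x (Q + k%:Z)); split.
- move=> k; rewrite (_ : P - k.+1%:Z = P - k%:Z - 1); last by lia.
  by apply: xR; lia.
- move=> k; rewrite (_ : Q + k.+1%:Z = Q + k%:Z + 1); last by lia.
  by apply: xL; lia.
- split=> //; last by rewrite subr0 addr0.
    by move=> i k iP ik; congr (x _); lia.
  by move=> i k iP ik; congr (x _); lia.
Qed.

Lemma tracks_glued x z y a b P Q : chain z -> chain y ->
  tracks x z y a b P Q -> glued P Q x.
Proof.
move=> cz cy [PQ xz xy zy]; split=> //.
- move=> i iP; pose k := (a + `|(P - i)%R|)%N.
  have -> : x i = z k by apply: xz; lia.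
  have -> : x (i - 1) = z k.+1 by apply: xz; lia.
  exact: cz.
- move=> i Qi; pose k := (b + `|(i - Q)%R|)%N.
  have -> : x i = y k by apply: xy; lia.
  have -> : x (i + 1) = y k.+1 by apply: xy; lia.
  exact: cy.
- have -> : x P = z a by apply: xz; lia.
  by rewrite zy; symmetry; apply: xy; lia.
Qed.

(** The gluing site need not be the maximal separating position. A defect of type R bounds the
    separating positions; if the maximal one lies beyond [P], it belongs to the L-type half, and the
    overlap alternative holds there. *)
Lemma Zpc_glued x :
  Zpc e r x <-> (SR x \/ SL x) \/ exists P Q, glued P Q x.
Proof.
split=> [[|[_ [p [[pR pL] _]] [xpp|[_ pL']]]]|[xRL|[P [Q xPQ]]]]; [by left| | |by left|].
- by right; exists p, (p + 1); split=> //; right.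
- by right; exists p, p; split=> //; left.
have [|nRL] := pselect (SR x \/ SL x); first by left.
right; have [PQ xR xL xE] := xPQ.
have IP : Isp x P.
  by split=> // i Pi; apply: xL; lia.
have [i0 ni0] : exists i0, ~ adm (x i0) (x (i0 - 1)).
  by apply: contrapT => ni; apply: nRL; left=> i; apply: contrapT => nadm; apply: ni; exists i.
have ltI q : Isp x q -> q < i0.
  by move=> [qR _]; rewrite ltNge; apply/negP => i0q; apply: ni0; apply: qR.
have exk : exists k : nat, `[< Isp x (P + k%:Z) >].
  by exists 0%N; rewrite addr0; apply/asboolP.
have ubk k : `[< Isp x (P + k%:Z) >] -> (k <= `|(i0 - P)%R|)%N.
  by move=> /asboolP/ltI; lia.
have [k /asboolP kI kmax] := ex_maxnP exk ubk.
split; first by split=> //; exists P.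
exists (P + k%:Z).
  split=> // q qI; have [qP|Pq] := leP q P; first by lia.
  have /kmax : `[< Isp x (P + `|(q - P)%R|%N%:Z) >].
    by apply/asboolP; rewrite (_ : P + _ = q) //; lia.
  by lia.
have [kR kL] := kI.
have [k0|k0] := posnP k.
  rewrite k0 addr0; case: PQ => QE; last by left; rewrite -QE xE.
  by right; split=> //; rewrite -QE.
right; split=> // i Pi; apply: xL.
by case: PQ => ->; lia.
Qed.

Lemma SR_GH x : SR x -> GH e r x = fun i => x (i - 1).
Proof.
move=> xR; apply/funext => i; apply: GH_right => //.
by have := xR (i + 1); rewrite addrK.
Qed.

Lemma SL_mirror x : SL x -> SR (mirror x).
Proof.
by move=> xL i; rewrite /mirror (_ : - (i - 1) = - i + 1) //; lia.
Qed.

Lemma SR_mirror x : SR x -> SL (mirror x).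
Proof.
by move=> xL i; rewrite /mirror (_ : - (i + 1) = - i - 1) //; lia.
Qed.

Lemma mirrorK x : mirror (mirror x) = x.
Proof. by apply/funext => i; rewrite /mirror opprK. Qed.

Lemma Zpc_GH x : Zpc e r x -> Zpc e r (GH e r x).
Proof.
have SRT w : SR w -> SR (GH e r w).
  by move=> wR; rewrite SR_GH // => i; exact: wR.
move=> /Zpc_glued[[xR|xL]|[P [Q xPQ]]]; apply/Zpc_glued.
- by left; left; exact: SRT.
- by left; right; rewrite -(mirrorK (GH _ _ _)) -GH_mirror //; apply/SR_mirror/SRT/SL_mirror.
right; have [z [y [cz cy tr]]] := glued_tracks xPQ.
have [a [b [P' [Q' [tr' _ _ _]]]]] := tracks_step e1 r1 cz cy tr.
by exists P', Q'; exact: tracks_glued tr'.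
Qed.

Lemma closed_glued P Q : closed (glued P Q).
Proof.
move=> x /closureP clx.
have [w [PQ _ _ _] _] := clx 0%N.
split=> // [i iP|i Qi|].
- have [y [_ yR _ _] xy] := clx (`|i| + 1)%N.
  by rewrite !xy; [exact: yR|lia|lia].
- have [y [_ _ yL _] xy] := clx (`|i| + 1)%N.
  by rewrite !xy; [exact: yL|lia|lia].
- have [y [_ _ _ yE] xy] := clx (`|P| + `|Q|)%N.
  by rewrite !xy; [exact: yE|lia|lia].
Qed.

(* A limit point outside SR and SL has a defect of each type; these confine
   the separating positions of the approximating points to a finite range. *)
Lemma closed_Zpc : closed (Zpc e r).
Proof.
move=> x clx; apply/Zpc_glued.
have [|nRL] := pselect (SR x \/ SL x); first by left.
have [i0 ni0] : exists i0, ~ adm (x i0) (x (i0 - 1)).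
  by apply: contrapT => ni; apply: nRL; left=> i; apply: contrapT => nadm; apply: ni; exists i.
have [i1 ni1] : exists i1, ~ adm (x i1) (x (i1 + 1)).
  by apply: contrapT => ni; apply: nRL; right=> i; apply: contrapT => nadm; apply: ni; exists i.
pose m := (`|i0| + `|i1| + 2)%N.
pose D := [set p : int * int | - m%:Z <= p.1 <= m%:Z /\ (p.2 = p.1 \/ p.2 = p.1 + 1)].
have finD : finite_set D.
  pose g (p : int * bool) := (p.1, p.1 + (p.2 : nat)%:Z).
  apply: (@sub_finite_set _ _ [set g (- m%:Z + k%:Z, b) | k in `I_(2 * m).+1 & b in setT]).
    move=> [p q] []; rewrite [_.1]/= [_.2]/= => pm pq.
    exists `|(p + m%:Z)%R|%N; first by rewrite /=; lia.
    have pE : - m%:Z + `|(p + m%:Z)%R|%N%:Z = p by lia.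
    by case: pq => ->; [exists false|exists true] => //; rewrite /g /= pE ?addr0.
  by apply: finite_image2; [exact: finite_II|exact: finite_finset].
have clU : closed (\bigcup_(p in D) glued p.1 p.2).
  by apply: closed_bigcup => // p _; exact: closed_glued.
suff : closure (\bigcup_(p in D) glued p.1 p.2) x.
  by move=> /clU[p _ xp]; right; exists p.1, p.2.
apply/closureP => k; have /closureP/(_ (maxn k m))[w Zw xw] := clx.
exists w; last by move=> i ik; apply: xw; lia.
have wi0 : ~ adm (w i0) (w (i0 - 1)) by rewrite -!xw; [exact: ni0|lia|lia].
have wi1 : ~ adm (w i1) (w (i1 + 1)) by rewrite -!xw; [exact: ni1|lia|lia].
case/Zpc_glued: Zw => [[wR|wL]|[P [Q wPQ]]]; [by case: wi0|by case: wi1|].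
exists (P, Q) => //; have [PQ wR wL _] := wPQ; split=> //=.
have P0 : P < i0 by rewrite ltNge; apply/negP => h; apply: wi0; exact: wR.
have Q1 : i1 < Q by rewrite ltNge; apply/negP => h; apply: wi1; exact: wL.
lia.
Qed.

Lemma compact_Zpc : compact (Zpc e r).
Proof.
by apply: (subclosed_compact closed_Zpc (@config_compact _)).
Qed.

End PulseCollision.

(** * Counting pulse words by an eigenvector *)

Lemma sorted_mkseq (E : rel nat) (f : nat -> nat) n :
  (forall k, (k.+1 < n)%N -> E (f k) (f k.+1)) -> sorted E (mkseq f n).
Proof.
move=> Ef; apply/(sortedP 0%N) => i; rewrite size_mkseq => i_n.
by rewrite !nth_mkseq ?Ef // ltnW.
Qed.

Section PulseWords.
Variable c : nat.
Hypothesis c1 : (1 <= c)%N.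

(** The transition graph is the cycle through 0, ..., c with a loop at 0; its characteristic
    polynomial is the one defining [rho]. *)
Definition pulse_succ (a : nat) : seq nat :=
  if a == 0%N then [:: 0%N; 1%N] else if (a < c)%N then [:: a.+1] else [:: 0%N].

Fixpoint pulse_words (n a : nat) : seq (seq nat) :=
  if n is m.+1 then [seq b :: w | b <- pulse_succ a, w <- pulse_words m b]
  else [:: [::]].

Lemma mem_pulse_succ a b : (a <= c)%N -> (b \in pulse_succ a) = pulse_step c a b.
Proof.
by rewrite /pulse_succ /pulse_step => ac; do ![case: ifP]; rewrite !inE; lia.
Qed.

Lemma pulse_step_le a b : pulse_step c a b -> (b <= c)%N.
Proof. by rewrite /pulse_step; lia. Qed.

Lemma mem_pulse_words n a w : (a <= c)%N ->
  (w \in pulse_words n a) = (size w == n) && path (pulse_step c) a w.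
Proof.
elim: n a w => [|n IH] a [|b w] ac //=.
  by apply/negP => /allpairsPdep[b [v [_ _]]].
rewrite eqSS andbCA; apply/allpairsPdep/andP => [[b' [v [bb' vw [-> ->]]]]|[ab bw]].
  move: bb'; rewrite mem_pulse_succ // => ab; split=> //.
  by rewrite -IH // (pulse_step_le ab).
exists b, w; split=> //; first by rewrite mem_pulse_succ.
by rewrite IH // (pulse_step_le ab).
Qed.

Lemma uniq_pulse_words n a : uniq (pulse_words n a).
Proof.
elim: n a => [|n IH] a //=; apply: allpairs_uniq_dep => //.
  by rewrite /pulse_succ; do ![case: ifP].
by move=> [b v] [b' v'] _ _ /= [-> ->].
Qed.

Lemma size_pulse_words n a :
  size (pulse_words n.+1 a) = \sum_(b <- pulse_succ a) size (pulse_words n b).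
Proof. by rewrite /= size_allpairs_dep sumnE big_map. Qed.

Definition all_pulse_words n := [seq w | a <- iota 0 c.+1, w <- pulse_words n a].

Lemma mem_all_pulse_words w : all (fun a => a <= c)%N w ->
  sorted (pulse_step c) w -> w \in all_pulse_words (size w).
Proof.
case: w => [|b w] /=.
  by move=> _ _; apply/allpairsPdep; exists 0%N, [::]; rewrite mem_iota.
(* [b.-1] is a predecessor of [b], for [b = 0] through the loop at 0. *)
move=> /andP[bc _] bw; apply/allpairsPdep; exists b.-1, (b :: w).
rewrite mem_iota -[pulse_words _ _]/(pulse_words (size (b :: w)) b.-1).
rewrite mem_pulse_words /=; last by lia.
by rewrite bw eqxx /pulse_step; split=> //; lia.
Qed.

Variable R : realType.
Let rh := rho R c.

(* The right eigenvector of the transition matrix pulse_step for the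
   eigenvalue rho, normalized so that its entries lie between 1 and rho^c. *)
Definition pulse_weight (a : nat) : R := if a is b.+1 then rh ^+ b else rh ^+ c.

Let rh1 : 1 <= rh. Proof. exact/ltW/rho_gt1. Qed.

Lemma pulse_weightE a : (a <= c)%N ->
  rh * pulse_weight a = \sum_(b <- pulse_succ a) pulse_weight b.
Proof.
rewrite /pulse_succ; case: a => [_|a ac] /=.
  rewrite !big_cons big_nil addr0 /= expr0.
  by have := rho_eq R c; rewrite mulrBr mulr1 -/rh mulrC => h; lra.
case: ifP => h; rewrite big_seq1 /= -exprS //.
by congr (_ ^+ _); lia.
Qed.

(** The weights satisfy the recursion of the word counts up to the factor [rh], and they are at
    least 1, the number of empty words. *)
Lemma size_pulse_words_le n a : (a <= c)%N ->
  (size (pulse_words n a))%:R <= pulse_weight a * rh ^+ n.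
Proof.
elim: n a => [|n IH] a ac.
  by rewrite mulr1 /pulse_weight; case: a ac => *; exact: exprn_ege1.
rewrite size_pulse_words natr_sum exprS mulrCA mulrA pulse_weightE // mulr_suml.
rewrite big_seq [leRHS]big_seq; apply: ler_sum => b; rewrite mem_pulse_succ //.
by move=> /pulse_step_le /IH.
Qed.

Lemma size_pulse_words_ge n : rh ^+ n <= (size (pulse_words n 0))%:R.
Proof.
(* No weight exceeds [rh ^+ c], and state 0 attains this value, so the factor cancels there. *)
suff H a : (a <= c)%N ->
    pulse_weight a * rh ^+ n <= rh ^+ c * (size (pulse_words n a))%:R.
  have := H 0%N (leq0n c); rewrite /pulse_weight ler_pM2l //.
  by rewrite exprn_gt0 // rho_gt0.
elim: n a => [|n IH] a ac.
  by rewrite !mulr1; case: a ac => // a ac; rewrite /= ler_weXn2l // ltnW.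
rewrite size_pulse_words natr_sum exprS mulrCA mulrA pulse_weightE // mulr_suml.
rewrite mulr_sumr big_seq [leRHS]big_seq; apply: ler_sum => b.
by rewrite mem_pulse_succ // => /pulse_step_le /IH.
Qed.

Lemma size_all_pulse_words n :
  (size (all_pulse_words n))%:R <= c.+1%:R * rh ^+ c * rh ^+ n.
Proof.
rewrite size_allpairs_dep sumnE big_map natr_sum.
apply: (@le_trans _ _ (\sum_(a <- iota 0 c.+1) rh ^+ c * rh ^+ n)); last first.
  by rewrite big_const_seq count_predT size_iota iter_addr_0 -(mulr_natl (_ * _)) mulrA.
rewrite big_seq [leRHS]big_seq; apply: ler_sum => a; rewrite mem_iota => ac.
apply: le_trans (size_pulse_words_le _ _) _; first by lia.
rewrite ler_wpM2r ?exprn_ge0 ?(le_trans ler01 rh1) //.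
by rewrite /pulse_weight; case: a ac => // a ac; apply: ler_weXn2l => //; lia.
Qed.

(** The first [k] cells belong to the R-type half; its word is read outwards, hence reversed. *)
Definition collision_words n :=
  [seq rev v.1 ++ v.2 | k <- iota 0 n.+1,
     v <- [seq (v1, v2) | v1 <- all_pulse_words k, v2 <- all_pulse_words (n - k)]].

Lemma size_collision_words n :
  (size (collision_words n))%:R <= n.+1%:R * (c.+1%:R * rh ^+ c) ^+ 2 * rh ^+ n.
Proof.
rewrite size_allpairs_dep sumnE big_map natr_sum.
apply: (@le_trans _ _
  (\sum_(k <- iota 0 n.+1) (c.+1%:R * rh ^+ c) ^+ 2 * rh ^+ n)); last first.
  by rewrite big_const_seq count_predT size_iota iter_addr_0 -(mulr_natl (_ * _)) mulrA.
rewrite big_seq [leRHS]big_seq; apply: ler_sum => k; rewrite mem_iota => kn.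
rewrite size_allpairs natrM.
rewrite (_ : _ * _ = (c.+1%:R * rh ^+ c * rh ^+ k) * (c.+1%:R * rh ^+ c * rh ^+ (n - k))).
  by apply: ler_pM; rewrite ?ler0n ?size_all_pulse_words.
have -> : rh ^+ n = rh ^+ k * rh ^+ (n - k).
  by rewrite -exprD; congr (_ ^+ _); lia.
by ring.
Qed.

End PulseWords.

(** * Upper bound for the entropy *)

Section PulseCollisionUpper.
Variables (e r : nat) (R : realType).
Hypotheses (e1 : (1 <= e)%N) (r1 : (1 <= r)%N).
Local Notation c := (e + r)%N.
Local Notation X := (config c.+1).
Implicit Types (x : X) (u v p i : int).

Definition word x u (n : nat) : seq nat :=
  mkseq (fun k => nat_of_ord (x (u + k%:Z) : 'I_c.+1)) n.

Lemma mkseq_pulse_words (g : nat -> 'I_c.+1) n :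
  (forall k, (k.+1 < n)%N -> adm (g k) (g k.+1)) ->
  mkseq (fun k => nat_of_ord (g k)) n \in all_pulse_words c n.
Proof.
move=> ag; have := @mem_all_pulse_words c (ltn_addr r e1) (mkseq (fun k => nat_of_ord (g k)) n).
rewrite size_mkseq; apply.
  by apply/allP => _ /mapP[k _ ->]; rewrite -ltnS.
by apply: sorted_mkseq => k kn; rewrite -admE //; exact: ag.
Qed.

(** The extreme values [p = u - 1] and [p = u + n - 1] cover windows that lie on one side of the
    collision. *)
Lemma word_split x u p n : u - 1 <= p <= u + n%:Z - 1 ->
  (forall i, u < i -> i <= p -> adm (x i) (x (i - 1))) ->
  (forall i, p < i -> i < u + n%:Z - 1 -> adm (x i) (x (i + 1))) ->
  word x u n \in collision_words c n.
Proof.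
move=> up xR xL; pose k := `|(p - u + 1)%R|%N.
have kn : (k <= n)%N by lia.
have pE : p = u + k%:Z - 1 by lia.
pose w1 := mkseq (fun j => nat_of_ord (x (p - j%:Z) : 'I_c.+1)) k.
pose w2 := mkseq (fun j => nat_of_ord (x (p + 1 + j%:Z) : 'I_c.+1)) (n - k).
apply/allpairsPdep; exists k, (w1, w2); split.
- by rewrite mem_iota; lia.
- apply/allpairsP; exists (w1, w2); split=> //=.
    apply: mkseq_pulse_words => j jk.
    have -> : p - j.+1%:Z = p - j%:Z - 1 by lia.
    by apply: xR; lia.
  apply: mkseq_pulse_words => j jk.
  have -> : p + 1 + j.+1%:Z = p + 1 + j%:Z + 1 by lia.
  by apply: xL; lia.
- have sw1 : size w1 = k by rewrite size_mkseq.
  apply: (@eq_from_nth _ 0%N) => [|j].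
    by rewrite size_cat size_rev !size_mkseq; lia.
  rewrite size_mkseq => jn; rewrite nth_mkseq // nth_cat size_rev sw1.
  case: ifP => jk.
    rewrite nth_rev ?sw1 // nth_mkseq; last by lia.
    by have -> : u + j%:Z = p - (k - j.+1)%N%:Z by lia.
  rewrite nth_mkseq; last by lia.
  by have -> : u + j%:Z = p + 1 + (j - k)%N%:Z by lia.
Qed.

Lemma Zpc_word x u n : Zpc e r x -> word x u n \in collision_words c n.
Proof.
move=> /(Zpc_glued e1 r1)[[xR|xL]|[P [Q [PQ xR xL _]]]].
- by apply: (@word_split _ _ (u + n%:Z - 1)) => [|i _ _|i]; [lia|exact: xR|lia].
- by apply: (@word_split _ _ (u - 1)) => [|i|i _ _]; [lia|lia|exact: xL].
have [Pu|uP] := ltP P (u - 1).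
  by apply: (@word_split _ _ (u - 1)) => [|i|i ui _]; [lia|lia|apply: xL; lia].
have [Pn|nP] := ltP P (u + n%:Z - 1); last first.
  apply: (@word_split _ _ (u + n%:Z - 1)) => [|i _ ip|i]; [lia| |lia].
  by apply: xR; lia.
apply: (@word_split _ _ P) => [|i _ iP|i Pi _]; [lia|exact: xR|apply: xL; lia].
Qed.

Lemma GH_local : local_map (Zpc e r) (GH e r) 1 1.
Proof.
move=> u v x y _ _ xy i uv; rewrite /GH.
have -> : x i = y i by apply: xy; lia.
have -> : x (i - 1) = y (i - 1) by apply: xy; lia.
by have -> : x (i + 1) = y (i + 1) by apply: xy; lia.
Qed.

Lemma iter_Zpc k x : Zpc e r x -> Zpc e r (iter k (GH e r) x).
Proof. by move=> Zx; elim: k => //= k; exact: Zpc_GH. Qed.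

Lemma entropy_Zpc_le (a : nat) :
  (entropy R (Zpc e r) (iter a (GH e r)) <= (2 * ln (rho R c ^+ a))%:E)%E.
Proof.
have c1 : (1 <= c)%N by lia.
have rh1 : 1 <= rho R c := ltW (rho_gt1 R c).
have rh0 := rho_gt0 R c.
have -> : 2 * ln (rho R c ^+ a) = ln (rho R c ^+ (2 * a)).
  by rewrite mulr_natl -lnXn ?exprn_gt0 // -exprM mulnC.
apply: (@entropy_le R _ _ _ _ a a).
- exact: iter_Zpc.
- exact: compact_Zpc.
- move=> u v x y Zx Zy xy.
  apply: (agree_iter (@Zpc_GH e r e1 r1) GH_local) => // i uv.
  by apply: xy; rewrite !mul1n in uv.
- exact: exprn_ege1.
move=> m; pose A : R := (c.+1%:R * rho R c ^+ c) ^+ 2.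
have A1 : 1 <= A.
  by rewrite exprn_ege1 // mulr_ege1 ?exprn_ege1 // ler1n.
(* The number [n.+1] of possible splits of the window is at most [(2 * m + 2 * a + 2) * k.+1]. *)
exists ((2 * m + 2 * a + 2)%:R * A * rho R c ^+ (2 * m).+1) => [|k].
  by rewrite !mulr_ege1 ?exprn_ege1 // ler1n; lia.
pose n := ((2 * m).+1 + 2 * a * k)%N.
exists (seq nat), (fun x => word x (- (m + a * k)%N%:Z) n), (collision_words c n).
split=> [x Zx|x y _ _ xy i uv|].
- exact: Zpc_word.
- have kn : (`|(i + (m + a * k)%N%:Z)%R| < n)%N by lia.
  have := congr1 (nth 0%N ^~ `|(i + (m + a * k)%N%:Z)%R|%N) xy.
  rewrite !nth_mkseq //.
  have -> : - (m + a * k)%N%:Z + `|(i + (m + a * k)%N%:Z)%R|%N%:Z = i by lia.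
  exact: val_inj.
- apply: le_trans (size_collision_words c1 R n) _.
  have -> : rho R c ^+ n = rho R c ^+ (2 * m).+1 * (rho R c ^+ (2 * a)) ^+ k.
    by rewrite -exprM -exprD.
  set s := rho R c ^+ (2 * m).+1; set t := (_ ^+ _) ^+ k.
  have -> : n.+1%:R * (c.+1%:R * rho R c ^+ c) ^+ 2 * (s * t) =
    n.+1%:R * (A * s * t) by rewrite /A; ring.
  have -> : (2 * m + 2 * a + 2)%:R * A * s * k.+1%:R * t =
    ((2 * m + 2 * a + 2) * k.+1)%:R * (A * s * t) by rewrite natrM; ring.
  rewrite ler_pM2r; last by rewrite !mulr_gt0 ?exprn_gt0 //; lra.
  by rewrite ler_nat /n; nia.
Qed.

End PulseCollisionUpper.

(** * Infinite concatenations of blocks *)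

Definition concat (L : nat) (bs : nat -> seq nat) (i : nat) : nat :=
  (if i is j.+1 then nth 0 (bs (j %/ L)) (j %% L) else 0)%N.

Section Concatenation.
Variables (c L : nat) (bs : nat -> seq nat).
Hypotheses (L0 : (0 < L)%N) (sz : forall k, size (bs k) = L)
  (pathb : forall k, path (pulse_step c) 0%N (bs k))
  (lastb : forall k, last 0%N (bs k) = 0%N).

Lemma concatS j s : (s < L)%N -> concat L bs (j * L + s).+1 = nth 0%N (bs j) s.
Proof.
by move=> sL; rewrite /= divnMDl // divn_small // addn0 modnMDl modn_small.
Qed.

(** Index [j * L] holds the last letter of the preceding block, or the initial letter; both are 0,
    so every block is read as a path starting at 0. *)
Lemma concat_cons j s : (s < L)%N ->
  concat L bs (j * L + s) = nth 0%N (0%N :: bs j) s.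
Proof.
case: s => [|s] sL; last by rewrite addnS concatS // ltnW.
case: j => [|j] //; rewrite mulSn addn0 addnC.
have -> : (j * L + L = (j * L + L.-1).+1)%N by lia.
by rewrite concatS ?prednK //= -(sz j) nth_last lastb.
Qed.

Lemma concat_step i : pulse_step c (concat L bs i) (concat L bs i.+1).
Proof.
have iL := ltn_pmod i L0.
rewrite {1 2}(divn_eq i L) concat_cons // concatS //.
by apply: (pathP 0%N (pathb _)); rewrite sz.
Qed.

Lemma count_concat (q j : nat) : (forall k, count_mem 1%N (bs k) = q) ->
  count (fun k => concat L bs k == 1%N) (iota 0 (j * L).+1) = (j * q)%N.
Proof.
move=> bq; elim: j => [|j IH]; first by rewrite mul0n.
have -> : ((j.+1 * L).+1 = (j * L).+1 + L)%N by lia.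
rewrite iotaD count_cat {}IH add0n mulSn addnC; congr (_ + _)%N.
rewrite -(bq j) -[in RHS](mkseq_nth 0%N (bs j)) sz /mkseq count_map.
rewrite -{1}(addn0 (j * L).+1) iotaDl count_map.
apply: eq_in_count => s; rewrite mem_iota => /andP[_ sL].
by rewrite -[LHS]/(concat L bs (j * L + s).+1 == 1%N) concatS.
Qed.

End Concatenation.

(** * Blocks with equally many pulses *)

Section Blocks.
Variable c : nat.
Hypothesis c1 : (1 <= c)%N.

(* From the state j the padding closes the current pulse and then emits
   exactly one further pulse; its length does not depend on j. *)
Definition padding (j : nat) : seq nat :=
  iota j.+1 (c - j) ++ nseq j.+1 0%N ++ iota 1 c ++ [:: 0%N].

Lemma size_padding j : (j <= c)%N -> size (padding j) = (2 * c + 2)%N.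
Proof. by move=> jc; rewrite !size_cat !size_iota size_nseq /=; lia. Qed.

Lemma path_iota_pulse a k : (a + k <= c)%N ->
  path (pulse_step c) a (iota a.+1 k) /\ last a (iota a.+1 k) = (a + k)%N.
Proof.
elim: k a => [|k IH] a /= ak; first by rewrite addn0.
have [-> ->] := IH a.+1 ltac:(lia).
by rewrite andbT /pulse_step; split; lia.
Qed.

Lemma path_padding j : (j <= c)%N ->
  path (pulse_step c) j (padding j) /\ last j (padding j) = 0%N.
Proof.
move=> jc; have [p1 l1] := @path_iota_pulse j (c - j) ltac:(lia).
have [p2 l2] := @path_iota_pulse 0 c ltac:(lia).
have lz m : last 0%N (nseq m 0%N) = 0%N by elim: m.
have pz m : path (pulse_step c) 0%N (nseq m 0%N) by elim: m.
rewrite /padding !last_cat !cat_path p1 l1 /= lz pz p2 l2 /=.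
by rewrite /pulse_step; split=> //; lia.
Qed.

Definition block (w : seq nat) := w ++ padding (last 0%N w).

Definition blocks n := [seq block w | w <- pulse_words c n 0].

Lemma blocks_uniq n : uniq (blocks n).
Proof.
rewrite map_inj_in_uniq ?uniq_pulse_words // => w w'.
rewrite !mem_pulse_words // => /andP[/eqP sw _] /andP[/eqP sw' _] /(congr1 (take n)).
by rewrite -{1}sw -sw' !take_size_cat // sw sw'.
Qed.

Lemma blocksP n b : b \in blocks n ->
  [/\ size b = (n + (2 * c + 2))%N, path (pulse_step c) 0%N b, last 0%N b = 0%N
    & (1 <= count_mem 1%N b)%N].
Proof.
move=> /mapP[w]; rewrite mem_pulse_words // => /andP[/eqP sw pw] ->.
have lw : (last 0%N w <= c)%N.
  case/lastP: w pw {sw} => // w a; rewrite rcons_path last_rcons => /andP[_].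
  exact: pulse_step_le.
have [pp lp] := path_padding lw.
rewrite /block size_cat sw size_padding // cat_path pw pp last_cat lp; split=> //.
have i1 : 1%N \in iota 1 c by rewrite mem_iota; lia.
by rewrite -has_count has_pred1 /padding !mem_cat i1 !orbT.
Qed.

Lemma pigeonhole_count (T : Type) (g : T -> nat) (s : seq T) (n : nat) :
  (0 < size s)%N -> all (fun b => 1 <= g b <= n)%N s ->
  exists2 q, (1 <= q)%N & (size s <= n * count (fun b => g b == q) s)%N.
Proof.
move=> s0 gs; apply: contrapT => nq.
have sumE : (\sum_(1 <= q < n.+1) count (fun b => g b == q) s = size s)%N.
  elim: s gs {s0 nq} => [|b s IH] /=; first by rewrite big1.
  move=> /andP[bn /IH {}IH]; rewrite big_split /= IH -[RHS]add1n; congr (_ + _)%N.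
  rewrite (bigD1_seq (g b)) ?iota_uniq ?mem_index_iota //= eqxx.
  by rewrite big1 // => q /negbTE; rewrite eq_sym => ->.
have lt q : (1 <= q)%N -> (n * count (fun b => g b == q) s <= (size s).-1)%N.
  move=> q1; rewrite -ltnS prednK // ltnNge; apply/negP => h.
  by apply: nq; exists q.
have : (n * size s <= n * (size s).-1)%N.
  rewrite -{1}sumE big_distrr /=.
  apply: (@leq_trans (\sum_(1 <= q < n.+1) (size s).-1)).
    rewrite big_nat [leqRHS]big_nat; apply: leq_sum => q /andP[q1 _]; exact: lt.
  by rewrite sum_nat_const_nat subSS subn0.
have n0 : (0 < n)%N by case: s gs s0 {nq sumE lt} => //= b s /andP[]; lia.
by rewrite leq_pmul2l //; lia.
Qed.

(** Fixing the most frequent pulse number costs only a factor equal to the block length, which does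
    not affect the exponential growth rate. *)
Lemma synchronized_blocks n : exists (F : seq (seq nat)) (q : nat),
  [/\ uniq F, (1 <= q)%N,
      (size (pulse_words c n 0) <= (n + (2 * c + 2)) * size F)%N
    & forall b, b \in F ->
        [/\ size b = (n + (2 * c + 2))%N, path (pulse_step c) 0%N b,
            last 0%N b = 0%N & count_mem 1%N b = q]].
Proof.
have B0 : (0 < size (blocks n))%N.
  rewrite size_map lt0n size_eq0; apply/negP => /eqP B0.
  have : nseq n 0%N \in pulse_words c n 0.
    by rewrite mem_pulse_words // size_nseq eqxx; elim: (n).
  by rewrite B0.
have [|q q1 szq] := @pigeonhole_count _ (count_mem 1%N) (blocks n) (n + (2 * c + 2)) B0.
  apply/allP => b /blocksP[<- _ _ ->] /=; exact: count_size.
exists [seq b <- blocks n | count_mem 1%N b == q], q; split=> //.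
- by rewrite filter_uniq // blocks_uniq.
- by rewrite size_filter -(size_map block).
- by move=> b; rewrite mem_filter => /andP[/eqP bq /blocksP[]].
Qed.

End Blocks.

(** * Observing collision orbits through a finite window *)

Section CollisionOrbits.
Variables e r : nat.
Hypotheses (e1 : (1 <= e)%N) (r1 : (1 <= r)%N).
Local Notation c := (e + r)%N.
Local Notation state := 'I_c.+1.
Local Notation X := (config c.+1).
Implicit Types (x : X) (z y : nat -> state) (i : int).

Definition glue z y : X := fun i => if i <= 0 then z `|i|%N else y `|i|%N.

Lemma tracks_glue z y : z 0%N = y 0%N -> tracks (glue z y) z y 0 0 0 0.
Proof.
move=> zy; split=> //; first by left.
  by move=> i k i0 ik; rewrite /glue i0; congr (z _); lia.
move=> i k i0 ik; rewrite /glue; have [i0'|_] := leP i 0.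
  have -> : k = 0%N by lia.
  by have -> : i = 0 by lia.
by congr (y _); lia.
Qed.

Lemma Zpc_glue z y : chain z -> chain y -> z 0%N = y 0%N -> Zpc e r (glue z y).
Proof.
move=> cz cy zy; apply/(Zpc_glued e1 r1); right; exists 0, 0.
exact: tracks_glued (tracks_glue zy).
Qed.

Lemma tracks_iter z y (t : nat) : chain z -> chain y -> z 0%N = y 0%N ->
  exists a b P Q, [/\ tracks (iter t (GH e r) (glue z y)) z y a b P Q,
    P + a%:Z = t%:Z, b%:Z - Q = t%:Z & pulses z a = pulses y b].
Proof.
move=> cz cy zy; elim: t => [|t [a [b [P [Q [tr Pa Qb pab]]]]]].
  exists 0%N, 0%N, 0, 0; split=> //; first exact: tracks_glue.
  by rewrite /pulses /= zy.
have [a' [b' [P' [Q' [tr' Pa' Qb' pab']]]]] := tracks_step e1 r1 cz cy tr.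
exists a', b', P', Q'; split=> //; [lia|lia|].
by move: pab'; rewrite pab addnC => /addnI.
Qed.

Variables L q : nat.
Hypotheses (L0 : (0 < L)%N) (q0 : (0 < q)%N).

Definition synchronized z :=
  [/\ chain z, z 0%N = ord0 & forall j, pulses z (j * L) = (j * q)%N].

Lemma leq_pulses z a b : (a <= b)%N -> (pulses z a <= pulses z b)%N.
Proof.
elim: b => [|b IH]; first by rewrite leqn0 => /eqP ->.
rewrite leq_eqVlt ltnS => /predU1P[->//|/IH ab].
by rewrite pulsesS (leq_trans ab) // leq_addr.
Qed.

(** If [a] exceeded [b + 2 * L], then [z] would have completed at least one block more than [y] has
    begun, hence shown at least [q > 0] additional pulses. *)
Lemma synchronized_close z y a b : synchronized z -> synchronized y ->
  pulses z a = pulses y b -> (a <= b + 2 * L)%N.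
Proof.
move=> [_ _ pz] [_ _ py] pab; rewrite leqNgt; apply/negP => ba.
have bL : (b <= (b %/ L).+1 * L)%N by rewrite ltnW // ltn_ceil.
have aL : ((b %/ L).+2 * L <= a)%N.
  by have := leq_trunc_div b L; rewrite !mulSn; lia.
have := leq_pulses z aL; have := leq_pulses y bL; rewrite pz py pab !mulSn.
lia.
Qed.

(** The shift relations give [P + Q = b - a], of modulus at most [2 * L]; hence [P >= - L] and
    [Q <= L], and outside [[-L, L]] both words are visible undisturbed. *)
Lemma synchronized_observe z y (t : nat) i : synchronized z -> synchronized y ->
  (i <= - L.+1%:Z -> iter t (GH e r) (glue z y) i = z `|(t%:Z - i)%R|%N) /\
  (L.+1%:Z <= i -> iter t (GH e r) (glue z y) i = y `|(t%:Z + i)%R|%N).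
Proof.
move=> sz sy; have [cz z0 _] := sz; have [cy y0 _] := sy.
have [a [b [P [Q [[PQ xz xy _] Pa Qb pab]]]]] :=
  tracks_iter t cz cy (etrans z0 (esym y0)).
have ab := synchronized_close sz sy pab.
have ba := synchronized_close sy sz (esym pab).
by split=> iL; [apply: xz|apply: xy]; lia.
Qed.

Lemma synchronized_determined (al k : nat) z y z' y' :
  synchronized z -> synchronized y -> synchronized z' -> synchronized y' ->
  (forall j, (j < k)%N -> agree (- (L.+1 + al)%N%:Z) (L.+1 + al)%N%:Z
     (iter j (iter al (GH e r)) (glue z y))
     (iter j (iter al (GH e r)) (glue z' y'))) ->
  forall i : nat, (0 < i <= al * k)%N -> z i = z' i /\ y i = y' i.
Proof.
move=> sz sy sz' sy' xx' i /andP[i0 ik].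
have k0 : (0 < k)%N by case: k ik {xx'} => //; rewrite muln0; lia.
have al0 : (0 < al)%N by case: al ik {xx'} => //; rewrite mul0n; lia.
(* Letters up to index [L.+1] are read off at time 0. *)
have [iL|Li] := leqP i L.+1.
  have h := xx' 0%N k0; split.
    have : glue z y (- i%:Z) = glue z' y' (- i%:Z) by apply: h; lia.
    by rewrite /glue oppr_le0 ltW ?ltr_nat // abszN.
  have : glue z y i%:Z = glue z' y' i%:Z by apply: h; lia.
  by rewrite /glue leNgt ltz_nat i0 /=.
(* At this sample the letters of index [i] stand at distance between [L.+1] and [L + al] from the
   origin: past the collision zone and inside the window. *)
pose j := ((i - L.+1) %/ al)%N.
have jE := divn_eq (i - L.+1) al; have jl := ltn_pmod (i - L.+1) al0.
have jk : (j < k)%N by rewrite /j ltn_divLR // mulnC; lia.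
have h := xx' j jk; rewrite -!iterM in h.
have jM : (j * al <= i)%N by rewrite /j; lia.
have jU : (i <= j * al + (L.+1 + al))%N by rewrite /j; lia.
have jD : (L.+1 <= i - j * al)%N by rewrite /j; lia.
pose p := ((i - j * al)%N)%:Z.
have hp : (L.+1 + al)%N%:Z >= p by rewrite /p; lia.
have [obs1 _] := @synchronized_observe z y (j * al) (- p) sz sy.
have [obs1' _] := @synchronized_observe z' y' (j * al) (- p) sz' sy'.
have [_ obs2] := @synchronized_observe z y (j * al) p sz sy.
have [_ obs2'] := @synchronized_observe z' y' (j * al) p sz' sy'.
have pE : `|((j * al)%N%:Z - - p)%R|%N = i by rewrite /p; lia.
have pE' : `|((j * al)%N%:Z + p)%R|%N = i by rewrite /p; lia.
rewrite pE in obs1 obs1'; rewrite pE' in obs2 obs2'.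
split.
  rewrite -obs1 -?obs1'; [apply: h|..]; rewrite /p; lia.
rewrite -obs2 -?obs2'; [apply: h|..]; rewrite /p; lia.
Qed.

End CollisionOrbits.

(** * Lower bound for the entropy *)

Section PulseCollisionLower.
Variables (e r : nat) (R : realType).
Hypotheses (e1 : (1 <= e)%N) (r1 : (1 <= r)%N).
Local Notation c := (e + r)%N.

Section BlockCode.
Variables (L q : nat) (F : seq (seq nat)).
Hypotheses (L0 : (0 < L)%N) (q0 : (0 < q)%N) (uF : uniq F) (F0 : (0 < size F)%N)
  (blockF : forall b, b \in F ->
     [/\ size b = L, path (pulse_step c) 0%N b, last 0%N b = 0%N
       & count_mem 1%N b = q]).

(** Beyond the [K] coded blocks, the first block of [F] is repeated, so that the infinite sequence
    stays synchronized. *)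
Definition code_block K (t : {ffun 'I_K -> 'I_(size F)}) (k : nat) : seq nat :=
  nth [::] F (if insub k is Some j then t j : nat else 0%N).

Definition code_seq K (t : {ffun 'I_K -> 'I_(size F)}) (i : nat) : 'I_c.+1 :=
  inord (concat L (code_block t) i).

Lemma code_block_in K (t : {ffun 'I_K -> 'I_(size F)}) k : code_block t k \in F.
Proof. by apply: mem_nth; case: insub. Qed.

Let code_concat K (t : {ffun 'I_K -> 'I_(size F)}) i :
  pulse_step c (concat L (code_block t) i) (concat L (code_block t) i.+1).
Proof.
by apply: concat_step => // k; have [] := blockF (code_block_in t k).
Qed.

Lemma code_seq_val K (t : {ffun 'I_K -> 'I_(size F)}) i :
  code_seq t i = concat L (code_block t) i :> nat.
Proof.
rewrite /code_seq inordK // ltnS; case: i => // i.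
have := code_concat t i; rewrite /pulse_step; lia.
Qed.

Lemma code_seq_synchronized K (t : {ffun 'I_K -> 'I_(size F)}) :
  synchronized L q (code_seq t).
Proof.
split=> [k||j].
- by rewrite admE // !code_seq_val; exact: code_concat.
- by apply: val_inj; rewrite /= code_seq_val.
have blk k := blockF (code_block_in t k).
have <- : count (fun k => concat L (code_block t) k == 1%N) (iota 0 (j * L).+1) =
    (j * q)%N.
  by apply: count_concat => // k; have [] := blk k.
by apply: eq_count => k; rewrite code_seq_val.
Qed.

Lemma code_seq_inj K (t t' : {ffun 'I_K -> 'I_(size F)}) :
  (forall i, (0 < i <= K * L)%N -> code_seq t i = code_seq t' i) -> t = t'.
Proof.
move=> tt'; apply/ffunP => j; apply: val_inj.
have : code_block t j = code_block t' j.
  have szb K' (s : {ffun 'I_K' -> 'I_(size F)}) : size (code_block s j) = L.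
    by have [] := blockF (code_block_in s j).
  apply: (@eq_from_nth _ 0%N) => [|s]; rewrite !szb // => sL.
  rewrite -(@concatS L (code_block t) L0) // -(@concatS L (code_block t') L0) //.
  rewrite -!code_seq_val tt' //=.
  by apply: (@leq_trans (j.+1 * L)); [rewrite mulSn; lia|rewrite leq_mul2r ltn_ord orbT].
rewrite /code_block valK => /eqP.
by rewrite nth_uniq // => /eqP.
Qed.

Lemma entropy_Zpc_ge_code (al : nat) :
  ((2 * al%:R * ln (size F)%:R / L%:R)%:E <=
     entropy R (Zpc e r) (iter al (GH e r)))%E.
Proof.
have lnF : 0 <= ln (size F)%:R :> R := ln_natr_ge0 R (size F).
apply: (@entropy_ge R _ _ _ (- (L.+1 + al)%N%:Z) (L.+1 + al)%N%:Z _
  (2 * ln (size F)%:R)); first by lia.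
(* [K] whole blocks fit into the [al * k] letters observed on each side. Rounding loses at most one
   block per side, whence the constant [2 * ln (size F)]. *)
move=> k; pose K := (al * k %/ L)%N.
pose T : finType := {ffun 'I_K -> 'I_(size F)}.
exists (T * T)%type, (fun t => glue (code_seq t.1) (code_seq t.2)); split.
- move=> t.
  have [cz z0 _] := code_seq_synchronized t.1.
  have [cy y0 _] := code_seq_synchronized t.2.
  by apply: Zpc_glue => //; rewrite z0 y0.
- move=> [t1 t2] [t1' t2'] /= tt'.
  have H := synchronized_determined e1 r1 L0 q0 (code_seq_synchronized t1)
    (code_seq_synchronized t2) (code_seq_synchronized t1')
    (code_seq_synchronized t2') tt'.
  have KL : (K * L <= al * k)%N by exact: leq_trunc_div.
  congr (_, _); apply: code_seq_inj => i /andP[i0 iK];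
    by have [|] := H i; rewrite ?i0 ?(leq_trans iK).
rewrite card_prod card_ffun !card_ord -expnD natrX lnXn ?ltr0n //.
have LR : 0 < L%:R :> R by rewrite ltr0n.
have kK : (al * k)%:R <= (K%:R + 1) * L%:R :> R.
  by rewrite natr1 -natrM ler_nat ltnW // ltn_ceil.
rewrite -[ln _ *+ _]mulr_natl addnn -muln2 natrM.
have -> : k%:R * (2 * al%:R * ln (size F)%:R / L%:R) =
    (al * k)%:R / L%:R * (2 * ln (size F)%:R) :> R.
  by rewrite natrM; field; rewrite gt_eqF.
move: kK; rewrite -ler_pdivrMr // => kK.
nra.
Qed.

End BlockCode.

Lemma entropy_Zpc_ge (al : nat) :
  ((2 * ln (rho R c ^+ al))%:E <= entropy R (Zpc e r) (iter al (GH e r)))%E.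
Proof.
have c1 : (1 <= c)%N by lia.
have lrh := ln_rho_gt0 R c; set h := ln (rho R c) in lrh.
apply/lee_addgt0Pr => eps eps0.
(* The loss in [h] per letter is at most [2 * d], which the factor [2 * al] turns into at most
   [eps]; the summand 1 keeps the denominator positive. *)
pose d := eps / (4 * (al%:R + 1)) : R.
have d0 : 0 < d by rewrite divr_gt0 // mulr_gt0 // ltr_wpDl.
(* This collects the cost of the padding, of length [2 * c + 2], and the constant in the linear
   bound of [ln L]; a large [n] makes it at most [d * n]. *)
pose C := (2 * c + 2)%:R * h + d - ln d.
have := near_le_pdivn C d0 => nearC.
have [n [Cn n0]] := filter_ex (filterI nearC (nbhs_infty_gt 0%N)).
have [F [q [uF q0 szF bF]]] := synchronized_blocks c1 n.
pose L := (n + (2 * c + 2))%N.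
have n0R : 0 < n%:R :> R by rewrite ltr0n.
have L0 : (0 < L)%N by rewrite /L; lia.
have LR : 0 < L%:R :> R by rewrite ltr0n.
have geF : rho R c ^+ n <= L%:R * (size F)%:R.
  apply: le_trans (size_pulse_words_ge c1 R n) _.
  by rewrite -natrM ler_nat.
have rhn : 0 < rho R c ^+ n by rewrite exprn_gt0 // rho_gt0.
have F0 : (0 < size F)%N.
  rewrite lt0n; apply/eqP => F0; move: geF; rewrite F0 mulr0; lra.
have FR : 0 < (size F)%:R :> R by rewrite ltr0n.
have lnF : n%:R * h <= ln L%:R + ln (size F)%:R.
  rewrite -lnM ?posrE // mulr_natl -lnXn ?rho_gt0 // ler_ln ?posrE //.
  by rewrite mulr_gt0.
apply: le_trans (leeD2r _ (entropy_Zpc_ge_code L0 q0 uF F0 bF al)).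
rewrite -EFinD lee_fin lnXn ?rho_gt0 // -/h -[h *+ al]mulr_natl.
have lnL : ln L%:R <= d * L%:R - ln d.
  have := ln_le_subr1 (mulr_gt0 d0 LR); rewrite lnM ?posrE //; lra.
have Cd : C <= d * n%:R by rewrite -ler_pdivrMr.
have key : h * L%:R - ln (size F)%:R <= 2 * d * L%:R.
  have LE : L%:R = n%:R + (2 * c + 2)%:R :> R by rewrite -natrD.
  move: Cd lnL lnF; rewrite /C LE.
  have : 0 <= d * (2 * c + 2)%:R by rewrite mulr_ge0 // ltW.
  nra.
have key' : h - 2 * d <= ln (size F)%:R / L%:R.
  by rewrite ler_pdivlMr //; lra.
have al0 : 0 <= al%:R :> R by [].
have dE : d * (4 * (al%:R + 1)) = eps.
  by rewrite /d divfK // gt_eqF // mulr_gt0 // ltr_wpDl.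
rewrite -(mulrA _ (ln _)) -mulrA -dE.
nra.
Qed.

Lemma entropy_Zpc (al : nat) :
  entropy R (Zpc e r) (iter al (GH e r)) = (2 * ln (rho R c ^+ al))%:E.
Proof.
by apply/eqP; rewrite eq_le entropy_Zpc_ge entropy_Zpc_le.
Qed.

End PulseCollisionLower.

(** * Asymptotics of the entropy *)

Section Asymptotics.
Variable R : realType.

(** The rescaling [a] cancels, so one limit serves all choices of alpha; the bounds on [c] and [a]
    make the denominator positive. *)
Lemma ln_rho_quotient c a : (2 <= c)%N -> (1 <= a)%N ->
  ((2 * ln (rho R c ^+ a))%:E / (2 * a%:R * (ln c%:R / c%:R))%:E)%E =
  (c%:R * ln (rho R c) / ln c%:R)%:E.
Proof.
move=> c2 a1.
have c0 : 0 < c%:R :> R by rewrite ltr0n; lia.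
have a0 : 0 < a%:R :> R by rewrite ltr0n.
have l0 : 0 < ln c%:R :> R by rewrite ln_gt0 // ltr1n.
rewrite inver gt_eqF; last by rewrite mulr_gt0 ?divr_gt0 ?mulr_gt0.
rewrite lnXn ?rho_gt0 // -EFinM -[ln _ *+ a]mulr_natl; congr _%:E.
by field; rewrite !gt_eqF.
Qed.

Lemma ln_rho_asympE :
  (c%:R * ln (rho R c) / ln c%:R)%:E @[c --> \oo] --> (1%E : \bar R).
Proof. by apply: cvg_EFin; [exact: nearW|exact: ln_rho_asymp]. Qed.

Lemma params_infty_asymp (f : nat * nat -> \bar R) :
  (forall e r, (1 <= e)%N -> (1 <= r)%N ->
     f (e, r) = ((e + r)%:R * ln (rho R (e + r)) / ln (e + r)%:R)%:E) ->
  f p @[p --> params_infty] --> (1%E : \bar R).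
Proof.
move=> fE A /ln_rho_asympE[N _ NA]; exists N => e r e1 r1 Ner /=.
by rewrite fE //; exact: NA.
Qed.

End Asymptotics.

Theorem corollary3p1 (R : realType) :
  (forall alpha : nat -> nat,
     (forall c : nat, (2 <= c)%N -> (1 <= alpha c)%N) ->
     [/\ forall e r : nat, (1 <= e)%N -> (1 <= r)%N ->
           entropy R (Zpc e r) (iter (alpha (e + r)%N) (GH e r)) =
           (2 * ln (rho R (e + r) ^+ alpha (e + r)%N))%:E,
         asymp \oo
           (fun c : nat => (2 * ln (rho R c ^+ alpha c))%:E)
           (fun c : nat => (2 * (alpha c)%:R * (ln c%:R / c%:R))%:E)
       & asymp params_infty
           (fun p : nat * nat =>
              entropy R (Zpc p.1 p.2)
                (iter (alpha (p.1 + p.2)%N) (GH p.1 p.2)))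
           (fun p : nat * nat =>
              let c := (p.1 + p.2)%N in
              (2 * (alpha c)%:R * (ln c%:R / c%:R))%:E)])
  /\ (asymp params_infty
        (fun p : nat * nat =>
           entropy R (Zpc p.1 p.2) (iter (p.1 + p.2)%N (GH p.1 p.2)))
        (fun p : nat * nat =>
           2%:E * entropy R setT (shiftZ (p.1 + p.2)%N))%E
      /\ asymp params_infty
           (fun p : nat * nat =>
              entropy R (Zpc p.1 p.2) (iter (p.1 + p.2)%N (GH p.1 p.2)))
           (fun p : nat * nat => (2 * ln (p.1 + p.2)%N%:R)%:E)).
Proof.
(* For [alpha c = c] the comparison function [2 * c * (ln c / c)] simplifies to [2 * ln c], twice
   the entropy of the full shift. *)
have shift_quotient e r : (1 <= e)%N -> (1 <= r)%N ->
    (entropy R (Zpc e r) (iter (e + r) (GH e r)) / (2 * ln (e + r)%N%:R)%:E)%E =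
    ((e + r)%:R * ln (rho R (e + r)) / ln (e + r)%:R)%:E.
  move=> e1 r1; rewrite entropy_Zpc // -(@ln_rho_quotient R (e + r) (e + r)); [|lia|lia].
  have : (0 < e + r)%N by lia.
  move: (e + r)%N => c c0; congr (_ / _%:E)%E.
  by field; rewrite pnatr_eq0 -lt0n.
split=> [alpha alpha1|]; first split.
- by move=> e r e1 r1; exact: entropy_Zpc.
- move=> A /ln_rho_asympE[N _ NA]; exists (maxn N 2) => // c /=.
  rewrite geq_max => /andP[Nc c2].
  by rewrite ln_rho_quotient ?alpha1 //; exact: NA.
- apply: params_infty_asymp => e r e1 r1 /=.
  by rewrite entropy_Zpc // ln_rho_quotient ?alpha1 //; lia.
split.
  apply: params_infty_asymp => e r e1 r1 /=.
  by rewrite entropy_shiftZ -?EFinM ?shift_quotient //; lia.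
by apply: params_infty_asymp => e r e1 r1 /=; exact: shift_quotient.
Qed.
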